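(* Let $E$ be a real Banach space. Then the following statements are equivalent to each other: (1) $E$ is reflexive. (2) For each proper l.s.c. convex function $f: E\to(-\infty,+\infty]$ such that $f$ has a bounded minimizing sequence, there exists $x_0\in E$ such that $f(x_0)=\inf_{x\in E}f(x)$. (3) For each bounded nonempty closed convex subset $A$ of $E$ and each proper l.s.c. convex function $f: A\to(-\infty,+\infty]$, there exists $x_0\in A$ such that $f(x_0)=\inf_{x\in A}f(x)$. (4) For each unbounded closed convex subset $A$ of $E$ and each coercive l.s.c. convex function $f: A\to(-\infty,+\infty)$, there exists $x_0\in A$ such that $f(x_0)=\inf_{x\in A}f(x)$. (5) For each unbounded closed convex subset $A$ of $E$ and each bounded coercive l.s.c. convex function $f: A\to(-\infty,+\infty)$, there exists $x_0\in A$ such that $f(x_0)=\inf_{x\in A}f(x)$. (6) For each coercive convex Lipschitz function $f: E\to(-\infty,+\infty)$, there exists $x_0\in E$ such that $f(x_0)=\inf_{x\in E}f(x)$. (7) For each unbounded closed convex subset $A$ of $E$ and each proper l.s.c. coercive convex function $f: A\to(-\infty,+\infty]$, there exists $x_0\in A$ such that $f(x_0)=\inf_{x\in A}f(x)$. (8) For each proper l.s.c. convex function $f: E\to(-\infty,+\infty]$ satisfying $f(x)\geq\varphi(\|x\|)+\beta$ for any $x\in E$, for some real number $\beta$ and some nondecreasing function $\varphi:[0,+\infty)\to[0,+\infty)$ with $\lim_{t\to+\infty}\varphi(t)=+\infty$, there exists $x_0\in E$ such that $f(x_0)=\inf_{x\in E}f(x)$. (9) For each bounded linear functional $g$ on $E$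 there exists $x_0\in E$ with $\|x_0\|\leq 1$ such that $g(x_0)=\|g\|$.
   Context: All normed spaces are over $\mathbb{R}$. Let $A$ be a nonempty subset of a normed space $(E,\|\cdot\|)$ and $f: A\to(-\infty,+\infty]$ a function. - $f$ is proper if $f(x_0)<+\infty$ for some $x_0\in A$. - $f$ is bounded if $f(D)$ is a bounded subset of $\mathbb{R}$ for each bounded subset $D$ of $A$ (so $f$ is real-valued); this does not mean $\sup_{x\in A}|f(x)|<+\infty$. - $f$ is l.s.c. (lower semicontinuous) if $\liminf_n f(x_n)\geq f(x)$ for every $x\in A$ and every sequence $(x_n)$ in $A$ with $\|x_n-x\|\to0$. - $f$ is coercive if $A$ is unbounded and $f(x)\to+\infty$ as $\|x\|\to+\infty$, $x\in A$. - A sequence $(x_n)_{n\in\mathbb{N}}$ in $A$ is a minimizing sequence of $f$ if $(f(x_n))_{n\in\mathbb{N}}$ converges to $\inf_{x\in A}f(x)$ in a nonincreasing manner. *)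

(* Defs.v *)
From HB Require Import structures.
From mathcomp Require Import all_boot all_order all_algebra.
From mathcomp Require Import all_classical all_reals all_analysis.

Set Implicit Arguments.
Unset Strict Implicit.
Unset Printing Implicit Defensive.

Import Order.TTheory GRing.Theory Num.Theory.
Import numFieldNormedType.Exports.

Local Open Scope classical_set_scope.
Local Open Scope ring_scope.

(* The dual of a normed space, as the subspace of the continuous linear maps in
   the space of all functions E -> R, normed by g |-> sup_(|x| <= 1) |g x|. *)
Section dual.
Context (R : realType) (E : normedModType R).

Definition dual_pred : {pred E -> R^o} :=
  fun g => `[< linear (g : E -> R^o) /\ continuous g >].

Lemma dual_pred_submod_closed : submod_closed dual_pred.
Proof.
split=> [|a g h /asboolP[lg cg] /asboolP[lh ch]]; apply/asboolP; split.
- by move=> b x y; rewrite scaler0 addr0.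
- exact: cst_continuous.
- move=> b x y; rewrite !fctE lg lh !scalerDr !scalerA mulrC.
  by rewrite addrACA.
- by move=> x; apply: cvgD; [apply: cvgZr; exact: cg|exact: ch].
Qed.

HB.instance Definition _ :=
  GRing.isSubmodClosed.Build R (E -> R^o) dual_pred dual_pred_submod_closed.

Record dual_space : Type :=
  Dual { dual_fun :> E -> R^o ; dual_funP : dual_fun \in dual_pred }.

HB.instance Definition _ := [isSub for dual_fun].
HB.instance Definition _ := [Choice of dual_space by <:].
HB.instance Definition _ := [SubChoice_isSubLmodule of dual_space by <:].

Lemma dual_linear (g : dual_space) : linear g.
Proof. by have /asboolP[] := dual_funP g. Qed.

HB.instance Definition _ (g : dual_space) :=
  GRing.isLinear.Build R E R^o *:%R g (dual_linear g).

Lemma dual_continuous (g : dual_space) : continuous g.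
Proof. by have /asboolP[] := dual_funP g. Qed.

Definition dual_norm (g : dual_space) : R :=
  sup [set `|g x| | x in [set x : E | `|x| <= 1]].

Lemma dual_norm_has_sup (g : dual_space) :
  has_sup [set `|g x| | x in [set x : E | `|x| <= 1]].
Proof.
split; first by exists `|g 0|, 0 => //=; rewrite normr0.
have /linear_bounded_continuous/bounded_funP/(_ 1)[M gM] := dual_continuous (g:=g).
by exists M => _ [x /= x1 <-]; exact: gM.
Qed.

Lemma dual_norm_ub (g : dual_space) x : `|x| <= 1 -> `|g x| <= dual_norm g.
Proof.
by move=> x1; apply: (sup_upper_bound (dual_norm_has_sup g)); exists x.
Qed.

Lemma dual_norm_le (g : dual_space) M :
  (forall x, `|x| <= 1 -> `|g x| <= M) -> dual_norm g <= M.
Proof.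
move=> gM; apply: ge_sup; first exact: (dual_norm_has_sup g).1.
by move=> _ [x /= x1 <-]; exact: gM.
Qed.

Lemma dual_norm_ge0 (g : dual_space) : 0 <= dual_norm g.
Proof. by apply: le_trans (dual_norm_ub g (x:=0) _); rewrite ?normr0. Qed.

Lemma ler_dual_normD (g h : dual_space) :
  dual_norm (g + h) <= dual_norm g + dual_norm h.
Proof.
apply: dual_norm_le => x x1.
by apply: le_trans (ler_normD _ _) _; apply: lerD; exact: dual_norm_ub.
Qed.

Lemma dual_normZ_le (l : R) (g : dual_space) :
  dual_norm (l *: g) <= `|l| * dual_norm g.
Proof.
apply: dual_norm_le => x x1.
have -> : (l *: g) x = l * g x by [].
by rewrite normrM ler_wpM2l// dual_norm_ub.
Qed.

Lemma dual_normZ (l : R) (g : dual_space) : dual_norm (l *: g) = `|l| * dual_norm g.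
Proof.
apply/eqP; rewrite eq_le dual_normZ_le /=.
have [->|l0] := eqVneq l 0; first by rewrite normr0 mul0r dual_norm_ge0.
rewrite -ler_pdivlMl ?normr_gt0// -normfV.
by apply: le_trans (dual_normZ_le _ _); rewrite scalerA mulVf// scale1r.
Qed.

Lemma dual_norm_eq0 (g : dual_space) : dual_norm g = 0 -> g = 0.
Proof.
move=> g0; apply: val_inj; apply/funext => x /=.
have [->|x0] := eqVneq x 0; first by rewrite linear0.
have nx0 : `|x| != 0 by rewrite normr_eq0.
have: `|g (`|x|^-1 *: x)| <= dual_norm g.
  by apply: dual_norm_ub; rewrite normrZ normfV normr_id mulVf.
rewrite g0 normr_le0 linearZ /= scaler_eq0 invr_eq0 (negbTE nx0) /=.
by move/eqP.
Qed.

HB.instance Definition _ :=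
  Lmodule_isNormed.Build R dual_space ler_dual_normD dual_normZ dual_norm_eq0.

End dual.

(* Surjectivity of the canonical map x |-> (g |-> g x) from E to its bidual. *)
Definition reflexive_space (R : realType) (E : normedModType R) : Prop :=
  forall Phi : dual_space (dual_space E), exists x : E, forall g : dual_space E, Phi g = g x.

(* A function A -> ]-oo, +oo] is encoded by a function E -> \bar R whose values
   outside A are irrelevant; [ninfty_free] says that -oo is not a value on A. *)
Section functions_on.
Context (R : realType) (E : normedModType R).
Implicit Types (A : set E) (f : E -> \bar R).
Local Open Scope ereal_scope.

Definition ninfty_free A f := forall x, A x -> -oo < f x.

Definition proper_on A f := exists2 x0, A x0 & f x0 < +oo.

Definition lsc_on A f := forall (x : E) (u : nat -> E),
  A x -> (forall n, A (u n)) -> (`|u n - x| @[n --> \oo] --> (0 : R))%R ->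
  f x <= limn_einf (f \o u).

Definition convex_on A f := forall (x y : E) (t : R),
  A x -> A y -> (0 <= t <= 1)%R ->
  f (t *: x + (1 - t) *: y)%R <= t%:E * f x + (1 - t)%:E * f y.

Definition coercive_on A f := ~ bounded_set A /\
  forall M : R, exists r : R, forall x, A x -> (r < `|x|)%R -> M%:E < f x.

Definition minimizing_sequence A f (u : nat -> E) :=
  [/\ forall n, A (u n), nonincreasing_seq (f \o u) &
      f (u n) @[n --> \oo] --> ereal_inf (f @` A)].

Definition attains_inf A f := exists2 x0, A x0 & f x0 = ereal_inf (f @` A).

End functions_on.

Definition bounded_function_on (R : realType) (E : normedModType R)
    (A : set E) (f : E -> R) :=
  forall D : set E, D `<=` A -> bounded_set D -> bounded_set (f @` D).

(* Main.v *)
From HB Require Import structures.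
Require Import Defs.
From mathcomp Require Import all_boot all_order all_algebra.
From mathcomp Require Import all_classical all_reals all_analysis.
From mathcomp Require Import ring lra.
Import Order.TTheory GRing.Theory Num.Theory.
Import numFieldNormedType.Exports.
Local Open Scope classical_set_scope.
Local Open Scope ring_scope.

Set Implicit Arguments.
Unset Strict Implicit.
Unset Printing Implicit Defensive.

(** The equivalence rests on two implications.

    Reflexivity forces attainment. Consider the sublevel sets of [f] at the
    levels above its infimum, cut by a ball that contains near-minimizers. They
    form a decreasing family of nonempty bounded convex sets, and a limit along
    it is a bounded functional on the dual; reflexivity turns that functional
    into a point of [E]. If the point were at a positive distance from some
    sublevel set, a hyperplane would separate the two, which a limit of points
    of the set forbids. Hence the point lies in every sublevel set
    ([reflexive_attains_inf]). Coercivity, a bounded domain or a bounded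
    minimizing sequence only serve to provide the ball.

    Attainment forces reflexivity. Minimizing [- g] on the unit ball, or the
    coercive convex Lipschitz function [support_gap g] on the whole space, amounts
    to finding a point of the unit ball where [g] reaches its norm. So each
    of the minimization properties implies that every functional attains its
    norm, and reflexivity follows by James' theorem ([james]).

    James' theorem is proved for arbitrary, possibly nonseparable, spaces.
    - A non-evaluation functional [Phi] on the dual is at a positive distance from
      [E]. Alternating the Hahn-Banach theorem and Goldstine's theorem gives
      functionals [f n] in the unit ball and bounded points [x n] such that
      [f n (x k)] is zero for [k < n] and bounded below for [k >= n]
      ([biorthogonal_sequences]). Hence the convex hull of the [f n] stays at a
      positive distance from all weak-* cluster points of the sequence.
    - By a diagonal argument due to Pryce one passes to a subsequence for which
      the distance from [h] to a cluster point [w] does not depend on [w], for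
      each [h] in the span of the sequence ([stable_subsequence]). This
      replaces the weak-* convergent subsequence of the separable case.
    - Convex blocks [g n] of that subsequence are chosen so that the norms of the
      partial sums of [\sum_i rho ^+ i *: (g i - w)] grow by at least a fixed
      multiple of [rho ^+ n] at step [n]. Because [rho] is small, a point at which
      the sum attains its norm must make every [g n - w] large; but [w] can be
      taken as a cluster point of the blocks themselves, and then this is
      impossible ([james_nonattaining]).

    Weak-* limits are never taken along a topology: a cone of eventual upper
    bounds is handed to the Hahn-Banach theorem in the form [hahn_banach_cone],
    and the linear functional that comes out respects them all. *)

(** * The Hahn-Banach theorem for cones *)

Section hahn_banach.
Context (R : realType) (V : lmodType R).

(** [K (z, c)] reads as the constraint that a functional be at most [c] at [z].
    Such constraints add up and scale; the last clause says that no combination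
    of them is contradictory at the origin. The epigraph of a sublinear function
    is the usual example. *)
Definition positive_cone (K : set (V * R)) :=
  [/\ forall z c z' c', K (z, c) -> K (z', c') -> K (z + z', c + c'),
      forall (t : R) z c, 0 <= t -> K (z, c) -> K (t *: z, t * c) &
      forall c, K (0, c) -> 0 <= c].

Lemma maximal_positive_cone (K0 : set (V * R)) :
  positive_cone K0 -> K0 !=set0 ->
  exists K, [/\ positive_cone K, K0 `<=` K &
    forall K', positive_cone K' -> K `<=` K' -> K' `<=` K].
Proof.
move=> pK0 K0n0.
pose P := [set K | positive_cone K /\ (K !=set0 -> K0 `<=` K)].
have [F FP Ftot|K [[pK K0K] Kmax]] := @Zorn_bigcup _ P.
  split; last first.
    move=> [p [X FX Xp]]; have [_ /(_ (ex_intro _ p Xp)) K0X] := FP _ FX.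
    by move=> q /K0X Xq; exists X.
  split=> [z c z' c' [X FX Xz] [Y FY Yz]|t z c t0 [X FX Xz]|c [X FX Xc]].
  - have [XY|YX] := Ftot _ _ FX FY.
      by exists Y => //; have [[YD _ _] _] := FP _ FY; apply: YD => //; exact: (XY (z, c)).
    by exists X => //; have [[XD _ _] _] := FP _ FX; apply: XD => //; exact: (YX (z', c')).
  - by exists X => //; have [[_ XZ _] _] := FP _ FX; exact: XZ.
  - by have [[_ _ X0] _] := FP _ FX; exact: X0.
(* The empty set is a positive cone and bounds the empty chain, so a maximal
   element has to be shown nonempty before it can be compared with K0. *)
have Kn0 : K !=set0.
  apply: contrapT => /set0P/negP/negPn/eqP K0'; have [p K0p] := K0n0.
  have /Kmax : K `<` K0 by rewrite K0'; split=> [//|/(_ _ K0p)].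
  by apply; split=> // _; exact: subset_refl.
exists K; split => //; first exact: K0K.
move=> K' pK' KK'; apply: contrapT => nK'K; apply: (Kmax K').
  by split.
split=> // _; apply: subset_trans KK'; exact: K0K.
Qed.

(** A maximal consistent set of constraints leaves no freedom: its lower envelope
    is sublinear and, being maximal, also odd, hence linear. *)
Lemma hahn_banach_cone (K0 : set (V * R)) :
  positive_cone K0 -> (forall z, exists c, K0 (z, c)) ->
  exists l : V -> R^o, linear l /\ forall z c, K0 (z, c) -> l z <= c.
Proof.
move=> pK0 K0z; have [c0 K0c0] := K0z 0.
have [K [[KD KZ Kpos] K0K Kmax]] :=
  maximal_positive_cone pK0 (ex_intro _ (0, c0) K0c0).
pose l z : R := inf [set c | K (z, c)].
have Kinf z : has_inf [set c | K (z, c)].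
  split; first by have [c /K0K] := K0z z; exists c.
  have [c' /K0K Kc'] := K0z (- z); exists (- c') => c /= Kc.
  have := KD _ _ _ _ Kc Kc'; rewrite subrr => /Kpos.
  by rewrite -lerBlDr sub0r.
have lK z c : K (z, c) -> l z <= c by move=> Kc; apply: ge_inf => //; exact: (Kinf z).2.
have l_ge z b : (forall c, K (z, c) -> b <= c) -> b <= l z.
  by move=> bK; apply: lb_le_inf; [exact: (Kinf z).1|move=> c; exact: bK].
have lD x y : l (x + y) <= l x + l y.
  rewrite -lerBlDr; apply: (l_ge) => c Kc; rewrite lerBlDr -lerBlDl.
  by apply: l_ge => d Kd; rewrite lerBlDl; exact/lK/KD.
have lZ t z : 0 < t -> l (t *: z) = t * l z.
  move=> t0; apply/eqP; rewrite eq_le; apply/andP; split.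
    rewrite -ler_pdivrMl//; apply: l_ge => c Kc; rewrite ler_pdivrMl//.
    by apply/lK/KZ => //; exact: ltW.
  apply: l_ge => c Kc; rewrite -ler_pdivlMl//; apply: lK.
  by rewrite -[z](scalerK (lt0r_neq0 t0)); apply: KZ => //; rewrite invr_ge0 ltW.
have l0 : l 0 = 0.
  apply/eqP; rewrite eq_le; apply/andP; split; last by apply: l_ge => c /Kpos.
  by apply: lK; have := KZ 0 _ _ (lexx 0) (K0K _ K0c0); rewrite scaler0 mul0r.
(* Adding the ray spanned by (- z, - l z) keeps the cone positive, since l is
   the lower envelope of K; by maximality this ray is already in K. *)
have lN z : l (- z) <= - l z.
  apply: (lK); pose K' := [set p | exists t u c,
    [/\ 0 <= t, K (u, c) & p = (u - t *: z, c - t * l z)]].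
  apply: (Kmax K').
  - split=> [x c x' c' [t [u [d [t0 Kd [-> ->]]]]] [t' [u' [d' [t'0 Kd' [-> ->]]]]]
            |s x c s0 [t [u [d [t0 Kd [-> ->]]]]]|c [t [u [d [t0 Kd [+ ->]]]]]].
    + exists (t + t'), (u + u'), (d + d'); split; [exact: addr_ge0|exact: KD|].
      by rewrite scalerDl mulrDl !opprD addrACA [X in (_, X)]addrACA.
    + exists (s * t), (s *: u), (s * d); split; [exact: mulr_ge0|exact: KZ|].
      by rewrite scalerBr mulrBr scalerA mulrA.
    + move=> /esym/eqP; rewrite subr_eq0 => /eqP E; rewrite subr_ge0.
      move: t0; rewrite le_eqVlt => /predU1P[t0|t0].
        by rewrite -t0 mul0r; apply: Kpos; rewrite E -t0 scale0r in Kd.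
      by rewrite -lZ//; apply: (lK); rewrite -E.
  - move=> [u c] Kc; exists 0, u, c; split => //.
    by rewrite scale0r mul0r !subr0.
  - exists 1, 0, 0; rewrite scale1r mul1r !sub0r; split => //.
    by have := KZ 0 _ _ (lexx 0) (K0K _ K0c0); rewrite scaler0 mul0r.
have lNE z : l (- z) = - l z.
  apply/eqP; rewrite eq_le lN /=.
  by have := lD (- z) z; rewrite addNr l0 -lerBlDr sub0r.
have lDE x y : l (x + y) = l x + l y.
  apply/eqP; rewrite eq_le lD /=.
  have := lD (- x) (- y); rewrite -opprD !lNE -opprD.
  by rewrite lerN2.
exists l; split=> [a x y|z c /K0K]; last exact: lK.
rewrite lDE; congr (_ + _).
have [a0|a0|->] := ltgtP a 0; last by rewrite !scale0r.
  by rewrite -[a]opprK scaleNr lNE lZ ?oppr_gt0// scaleNr.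
exact: lZ.
Qed.

End hahn_banach.

(** * Functionals on a normed space *)

Lemma convex_setP (R : realType) (V : lmodType R) (A : set V) :
  convex_set A <-> forall x y (t : R), 0 <= t -> t <= 1 -> A x -> A y ->
    A (t *: x + (1 - t) *: y).
Proof.
split=> [cA x y t t0 t1 Ax Ay|cA x y l /set_mem Ax /set_mem Ay].
  have /andP t01 : 0 <= t <= 1 by rewrite t0.
  have := cA x y (Itv01 t0 t1) (mem_set Ax) (mem_set Ay).
  by move/set_mem.
by apply/mem_set; apply: cA.
Qed.

Lemma convex_set_combination (R : realType) (V : lmodType R) (C : set V) (s t : R) x y :
  convex_set C -> 0 <= s -> 0 <= t -> C x -> C y ->
  exists2 z, C z & (s + t) *: z = s *: x + t *: y.
Proof.
move=> /convex_setP cC s0 t0 Cx Cy.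
have [st|st] := eqVneq (s + t) 0.
  have [-> ->] : s = 0 /\ t = 0 by split; lra.
  by exists x => //; rewrite addr0 !scale0r addr0.
have st0 : 0 < s + t by rewrite lt0r st addr_ge0.
exists ((s / (s + t)) *: x + (1 - s / (s + t)) *: y).
  by apply: cC => //; [rewrite divr_ge0// ltW|rewrite ler_pdivrMr// mul1r lerDl].
rewrite scalerDr !scalerA mulrCA divff// mulr1; congr (_ + _ *: _).
by rewrite mulrBr mulr1 mulrCA divff// mulr1 addrC addKr.
Qed.

Section dual_theory.
Context (R : realType) (E : normedModType R).
Implicit Types (g h : dual_space E) (x y z : E).

Lemma dualD g h x : (g + h) x = g x + h x. Proof. by []. Qed.
Lemma dualN g x : (- g) x = - g x. Proof. by []. Qed.
Lemma dualB g h x : (g - h) x = g x - h x. Proof. by []. Qed.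
Lemma dualZ (a : R) g x : (a *: g) x = a * g x. Proof. by []. Qed.
Lemma dualZr (a : R) g x : g (a *: x) = a * g x. Proof. exact: linearZ. Qed.
Lemma dualDr g x y : g (x + y) = g x + g y. Proof. exact: linearD. Qed.
Lemma dualBr g x y : g (x - y) = g x - g y. Proof. exact: linearB. Qed.
Lemma dualNr g x : g (- x) = - g x. Proof. exact: linearN. Qed.

Lemma dual_ler_norm g x : g x <= `|g| * `|x|.
Proof.
have [->|x0] := eqVneq x 0; first by rewrite linear0 normr0 mulr0.
have nx0 : 0 < `|x| by rewrite normr_gt0.
rewrite -ler_pdivrMr//.
have -> : g x / `|x| = g (`|x|^-1 *: x) by rewrite linearZ /= mulrC.
apply: le_trans (ler_norm _) _; apply: dual_norm_ub.
by rewrite normrZ normfV normr_id mulVf ?gt_eqF.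
Qed.

Lemma dual_norm_bound g (M : R) :
  0 <= M -> (forall x, g x <= M * `|x|) -> `|g| <= M.
Proof.
move=> M0 gM; apply: dual_norm_le => x x1; rewrite ler_norml.
have Mx y : `|y| <= 1 -> g y <= M.
  by move=> y1; apply: le_trans (gM y) _; rewrite ler_piMr.
by rewrite Mx// lerNl -linearN/= Mx// normrN.
Qed.

Lemma dual_norm_ball g (M : R) :
  (forall x, `|x| <= 1 -> g x <= M) -> `|g| <= M.
Proof.
move=> gM; apply: dual_norm_le => x x1; rewrite ler_norml gM// andbT.
by rewrite lerNl -linearN/= gM// normrN.
Qed.

Lemma dual_of_linear (l : E -> R^o) (M : R) :
  linear l -> 0 <= M -> (forall x, l x <= M * `|x|) ->
  exists2 g : dual_space E, (forall x, g x = l x) & `|g| <= M.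
Proof.
move=> ll M0 lM.
pose L : {linear E -> R^o} := HB.pack l (GRing.isLinear.Build R E R^o *:%R l ll).
have lLM x : `|L x| <= M * `|x|.
  by rewrite ler_norml lM andbT lerNl -linearN/= -(normrN x) lM.
have Lc : continuous L.
  apply/linear_bounded_continuous/bounded_funP => r; exists (M * r) => x xr.
  by apply: le_trans (lLM x) _; rewrite ler_wpM2l.
have Ldual : (L : E -> R^o) \in @dual_pred R E by apply/asboolP.
exists (Dual Ldual) => //.
exact: dual_norm_bound.
Qed.

(** A constraint [c <= M * `|z|] at every point bounds the functional, so that the
    cone form of Hahn-Banach produces an element of the dual. *)
Lemma hahn_banach_dual (K : set (E * R)) (M : R) :
  positive_cone K -> 0 <= M ->
  (forall z, exists2 c, K (z, c) & c <= M * `|z|) ->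
  exists2 g : dual_space E, `|g| <= M & forall z c, K (z, c) -> g z <= c.
Proof.
move=> pK M0 KM.
have [|l [ll lK]] := hahn_banach_cone pK.
  by move=> z; have [c] := KM z; exists c.
have [|g gl gM] := dual_of_linear ll M0.
  by move=> z; have [c /lK lc] := KM z; exact: le_trans.
by exists g => // z c Kc; rewrite gl; exact: lK.
Qed.

(** The functions [z |-> `|z + t *: (y - x)| - t * r], with [y] in [C] and [0 <= t],
    generate a sublinear function below the norm. A linear functional below it
    has norm at most one, and its value at [x - y] is at most [- r], as is seen
    by taking [t = 1]. *)
Lemma separation (C : set E) x (r : R) :
  convex_set C -> C !=set0 -> (forall y, C y -> r <= `|y - x|) ->
  exists2 g : dual_space E, `|g| <= 1 & forall y, C y -> g x + r <= g y.
Proof.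
move=> cC [y0 Cy0] Cr.
pose K : set (E * R) := [set p | exists t y,
  [/\ 0 <= t, C y & `|p.1 + t *: (y - x)| - t * r <= p.2]].
have [||z|g g1 gK] := @hahn_banach_dual K 1.
- split=> [z c z' c' [t [y /= [t0 Cy tc]]] [t' [y' /= [t'0 Cy' tc']]]
          |s z c s0 [t [y /= [t0 Cy tc]]]|c [t [y /= [t0 Cy tc]]]].
  + have [y2 Cy2 y2E] := convex_set_combination cC t0 t'0 Cy Cy'.
    exists (t + t'), y2; split=> /=; [exact: addr_ge0|by []|].
    have -> : z + z' + (t + t') *: (y2 - x) =
              (z + t *: (y - x)) + (z' + t' *: (y' - x)).
      rewrite [RHS]addrACA; congr (_ + _).
      by rewrite !scalerBr y2E scalerDl opprD addrACA.
    rewrite mulrDl opprD; apply: le_trans (lerD tc tc').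
    by rewrite [leRHS]addrACA lerD2r ler_normD.
  + exists (s * t), y; split=> /=; [exact: mulr_ge0|by []|].
    rewrite -scalerA -scalerDr normrZ ger0_norm// -mulrA -mulrBr.
    exact: ler_wpM2l.
  + apply: le_trans tc; rewrite add0r normrZ ger0_norm// -mulrBr mulr_ge0//.
    by rewrite subr_ge0 Cr.
- by [].
- exists `|z|; rewrite ?mul1r//; exists 0, y0; split=> //=.
  by rewrite scale0r mul0r addr0 subr0.
- exists g => // y Cy; rewrite -lerBrDl -linearB/= -lerN2 -linearN/=.
  apply: gK; exists 1, y; split=> //=.
  by rewrite scale1r addNr normr0 mul1r sub0r.
Qed.

(** This is the separation of the origin from the point [x]. *)
Lemma norming_functional x : exists2 g : dual_space E, `|g| <= 1 & g x = `|x|.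
Proof.
have [||y /= ->|g g1 gx] := @separation [set x] 0 `|x|.
- apply/convex_setP => _ _ t _ _ -> ->.
  by rewrite -scalerDl addrC subrK scale1r.
- by exists x.
- by rewrite subr0.
exists g => //; apply/eqP; rewrite eq_le; apply/andP; split.
  by apply: le_trans (dual_ler_norm g x) _; rewrite ler_piMl.
by have := gx _ erefl; rewrite linear0 add0r.
Qed.

(** The functional [w] plays the role of a weak-* cluster point of the sequence.
    The constraints are the eventual upper bounds; applied to [- z], they yield
    the eventual lower bounds too. *)
Lemma cluster_functional (phi : nat -> dual_space E) (M : R) :
  (forall n, `|phi n| <= M) ->
  exists2 w : dual_space E, `|w| <= M &
    forall z c, (\forall n \near \oo, phi n z <= c) -> w z <= c.
Proof.
move=> phiM.
have M0 : 0 <= M by apply: le_trans (phiM 0%N).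
have [||z|w wM wK] := @hahn_banach_dual
    [set p | \forall n \near \oo, phi n p.1 <= p.2] M.
- split=> [z c z' c' /= zc z'c'|t z c t0 /= zc|c /= [N _ /(_ N (leqnn N))/=]].
  + by near=> n; rewrite linearD lerD//; near: n.
  + by near=> n; rewrite linearZ ler_wpM2l//; near: n.
  + by rewrite linear0.
- by [].
- exists (M * `|z|) => //=; apply: nearW => n.
  by apply: le_trans (dual_ler_norm _ _) _; rewrite ler_wpM2r.
by exists w.
Unshelve. all: by end_near. Qed.

End dual_theory.

(** * The bidual and functionals that are not evaluations *)

Section bidual.
Context (R : realType) (E : normedModType R).
Implicit Types (x y : E) (f : dual_space E) (Phi : dual_space (dual_space E)).

Lemma evaluation_subproof x :
  exists2 J : dual_space (dual_space E), (forall f, J f = f x) & `|J| <= `|x|.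
Proof.
apply: (@dual_of_linear _ (dual_space E) (fun f => f x)) => //.
by move=> f; rewrite mulrC dual_ler_norm.
Qed.

Definition evaluation x : dual_space (dual_space E) :=
  s2val (cid2 (evaluation_subproof x)).

Lemma evaluationE x f : evaluation x f = f x.
Proof. by rewrite /evaluation; case: cid2. Qed.

Lemma dual_sum_apply (I : finType) (F : I -> dual_space E) x :
  (\sum_i F i) x = \sum_i F i x.
Proof.
by rewrite -evaluationE linear_sum /=; under eq_bigr do rewrite evaluationE.
Qed.

(** A functional that vanishes on a finite intersection of kernels is a
    combination of the functionals defining them; here these are evaluations, and
    so is the combination. *)
Lemma evaluation_of_finite_kernel (s : seq E) Phi :
  (forall f, (forall x, x \in s -> f x = 0) -> Phi f = 0) ->
  exists y, forall f, Phi f = f y.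
Proof.
elim: s Phi => [|x s IH] Phi Phis.
  by exists 0 => f; rewrite linear0 Phis.
have [[v [vs vx]]|nv] :=
    pselect (exists v : dual_space E, (forall y, y \in s -> v y = 0) /\ v x != 0).
  have [|y yE] := IH (Phi - (Phi v / v x) *: evaluation x).
    move=> f fs; rewrite dualB dualZ evaluationE.
    have -> : Phi v / v x * f x = f x / v x * Phi v.
      by rewrite mulrAC [RHS]mulrAC [f x * _]mulrC.
    have <- : Phi (f - (f x / v x) *: v) = Phi f - f x / v x * Phi v.
      by rewrite linearB /= dualZr.
    apply: Phis => y.
    rewrite inE => /predU1P[->|ys]; first by rewrite dualB dualZ divfK// subrr.
    by rewrite dualB dualZ (vs y ys) mulr0 fs// subrr.
  exists (y + (Phi v / v x) *: x) => f.
  rewrite linearD /= dualZr -yE dualB dualZ evaluationE.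
  by rewrite subrK.
apply: IH => f fs; apply: Phis => y; rewrite inE => /predU1P[->|/fs//].
by apply: contrapT => /eqP fx; apply: nv; exists f.
Qed.

(** If [Phi] were at most [theta * `|f|] on the annihilator of [s], its restriction
    there would extend to some [Psi] of norm at most [theta], and [Phi - Psi],
    which kills the annihilator, would be an evaluation within [theta] of
    [Phi]. *)
Lemma annihilator_norming (theta : R) Phi (s : seq E) : 0 <= theta ->
  ~ (exists y, forall f, Phi f - f y <= theta * `|f|) ->
  exists f, [/\ `|f| <= 1, forall x, x \in s -> f x = 0 & theta < Phi f].
Proof.
move=> theta0 far; apply: contrapT => nof; apply: far.
pose N : set (dual_space E) := [set f | forall x, x \in s -> f x = 0].
have PhiN f : N f -> Phi f <= theta * `|f|.
  move=> Nf; rewrite leNgt; apply/negP => ltf; apply: nof.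
  have f0 : 0 < `|f|.
    rewrite normr_gt0; apply: contraTneq ltf => ->.
    by rewrite linear0 normr0 mulr0 ltxx.
  exists (`|f|^-1 *: f); split=> [|x xs|].
  - by rewrite normrZ normfV normr_id mulVf ?gt_eqF.
  - by rewrite dualZ Nf// mulr0.
  - by rewrite dualZr mulrC ltr_pdivlMr.
have NZ (t : R) f : N f -> N (t *: f).
  by move=> Nf x xs; rewrite dualZ Nf// mulr0.
have ND f g : N f -> N g -> N (f + g).
  by move=> Nf Ng x xs; rewrite dualD Nf// Ng// addr0.
have N0 : N 0 by [].
(* This cone generates the infimal convolution of the norm theta * `|.| and of
   Phi restricted to N; a functional below it agrees with Phi on N. *)
have [||f|Psi PsiM PsiK] := @hahn_banach_dual R (dual_space E)
  [set p | exists2 n, N n & theta * `|p.1 - n| + Phi n <= p.2] theta.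
- split=> [f c g d [n /= Nn nc] [m /= Nm md]|t f c t0 [n /= Nn nc]|c [n /= Nn nc]].
  + exists (n + m) => /=; first exact: ND.
    apply: le_trans (lerD nc md); rewrite [leRHS]addrACA dualDr lerD2r.
    by rewrite -mulrDr ler_wpM2l// opprD addrACA ler_normD.
  + exists (t *: n) => /=; first exact: NZ.
    rewrite -scalerBr normrZ ger0_norm// dualZr mulrCA -mulrDr.
    exact: ler_wpM2l.
  + apply: le_trans nc; rewrite sub0r normrN -lerBlDr sub0r -dualNr -normrN.
    by apply: PhiN; rewrite -scaleN1r; exact: NZ.
- by [].
- exists (theta * `|f|) => //; exists 0 => //=.
  by rewrite subr0 linear0 addr0.
have PsiN n : N n -> Psi n <= Phi n.
  by move=> Nn; apply: PsiK; exists n => //=; rewrite subrr normr0 mulr0 add0r.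
have [|y yE] := @evaluation_of_finite_kernel s (Phi - Psi).
  move=> n Nn; apply/eqP; rewrite dualB subr_eq0 eq_le PsiN// andbT.
  have /PsiN : N (- n) by rewrite -scaleN1r; exact: NZ.
  by rewrite !linearN lerN2.
exists y => f; rewrite -yE dualB opprB addrC subrK.
by apply: le_trans (dual_ler_norm _ _) _; rewrite ler_wpM2r.
Qed.

(** Otherwise the image of the ball of radius [`|Phi|] under the finitely many
    functionals in [s] would be separated from their values under [Phi], by a
    linear form on the coordinates. That form is a combination [F] of [s], and it
    would give [`|Phi| * `|F| < `|Phi F|]. *)
Lemma goldstine_finite Phi (s : seq (dual_space E)) (e : R) : 0 < e ->
  exists2 x, `|x| <= `|Phi| & forall f, f \in s -> Phi f - e <= f x.
Proof.
move=> e0; apply: contrapT => nox.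
pose M := `|Phi|; pose n := size s.
(* One extra coordinate, constantly zero by the default of nth, lets the row space
   have positive dimension even if s is empty. *)
pose c x : 'rV[R]_n.+1 := \row_i (nth 0 s i) x.
pose z : 'rV[R]_n.+1 := \row_i Phi (nth 0 s i).
have cD x y (t : R) : c (t *: x + y) = t *: c x + c y.
  by apply/rowP => i; rewrite !mxE linearD linearZ.
have [|||g _ gC] := @separation R 'rV[R]_n.+1 (c @` [set x | `|x| <= M]) z e.
- apply/convex_setP => _ _ t t0 t1 [x /= xM <-] [y /= yM <-].
  exists (t *: x + (1 - t) *: y) => /=; last first.
    by rewrite cD -[(1 - t) *: y]addr0 cD; congr (_ + _); apply/rowP=> i; rewrite !mxE linear0 addr0.
  apply: le_trans (ler_normD _ _) _; rewrite !normrZ !ger0_norm ?subr_ge0//.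
  have -> : M = t * M + (1 - t) * M by rewrite -mulrDl addrC subrK mul1r.
  by rewrite lerD// ler_wpM2l// subr_ge0.
- by exists (c 0), 0 => //=; rewrite normr0 /M.
- move=> _ [x /= xM <-]; apply: contrapT => /negP; rewrite -ltNge => cz.
  apply: nox; exists x => // f fs.
  have fi : (index f s < n.+1)%N by rewrite ltnS index_size.
  have : `|(c x - z) ord0 (Ordinal fi)| <= `|c x - z|.
    rewrite [leRHS]/Num.norm/= mx_normrE.
    by apply/bigmax_geP; right => /=; exists (ord0, Ordinal fi).
  rewrite !mxE /= nth_index// => /le_lt_trans /(_ cz).
  by rewrite ltr_norml => /andP[+ _]; rewrite ltrBrDr => /ltW; rewrite addrC.
pose F : dual_space E := \sum_i g (delta_mx 0 i) *: nth 0 s i.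
have gE (u : 'rV[R]_n.+1) : g u = \sum_i g (delta_mx 0 i) * u 0 i.
  rewrite {1}(row_sum_delta u) linear_sum /=; apply: eq_bigr => i _.
  by rewrite linearZ /= mulrC.
have gc x : g (c x) = F x.
  by rewrite gE dual_sum_apply; apply: eq_bigr => i _; rewrite mxE.
have gz : g z = Phi F.
  by rewrite gE linear_sum; apply: eq_bigr => i _; rewrite mxE linearZ.
have : `|M *: F| <= - (Phi F + e).
  apply: dual_norm_ball => x x1; rewrite dualZ -dualZr lerNr -linearN/= -gc -gz.
  apply: gC; exists (- (M *: x)) => //=.
  by rewrite normrN normrZ normr_id ler_piMr.
rewrite normrZ normr_id; have := dual_ler_norm Phi (- F).
rewrite linearN normrN /M; lra.
Qed.

(** Each [f n] is chosen in the annihilator of the points found so far, with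
    [Phi (f n)] above [theta]; then [x n] is chosen by Goldstine's theorem so that
    [f 0], ..., [f n] take at [x n] values close to their values under [Phi]. *)
Lemma biorthogonal_sequences (theta : R) Phi : 0 < theta ->
  ~ (exists y, forall f, Phi f - f y <= theta * `|f|) ->
  exists (f : nat -> dual_space E) (x : nat -> E),
    [/\ forall n, `|f n| <= 1, forall n, `|x n| <= `|Phi|,
        forall n k, (k < n)%N -> f n (x k) = 0 &
        forall n k, (n <= k)%N -> theta / 2 <= f n (x k)].
Proof.
move=> theta0 far.
pose good (s : seq (dual_space E * E)) := forall p, p \in s -> theta < Phi p.1.
have /choice[next nextP] (s : seq (dual_space E * E)) : exists p : dual_space E * E, good s ->
    [/\ `|p.1| <= 1, `|p.2| <= `|Phi|, forall q, q \in s -> p.1 q.2 = 0,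
        good (p :: s) & forall q, q \in p :: s -> theta / 2 <= q.1 p.2].
  have [f [f1 fs Phif]] := annihilator_norming (map snd s) (ltW theta0) far.
  have [x xPhi xf] : exists2 x, `|x| <= `|Phi| &
      forall g, g \in f :: map fst s -> Phi g - theta / 2 <= g x.
    by apply: goldstine_finite; rewrite divr_gt0.
  exists (f, x) => gs; have gs' : good ((f, x) :: s).
    by move=> p; rewrite inE => /predU1P[->//|/gs].
  split=> //= [q qs|q qs]; first by apply: fs; exact: map_f.
  have := gs' q qs; have : q.1 \in f :: map fst s by exact: (map_f fst qs).
  by move=> /xf; lra.
pose s n := iter n (fun s => next s :: s) [::].
have sgood n : good (s n).
  by elim: n => [//|n IH] /=; have [] := nextP _ IH.
have mem_s n k : (k < n)%N -> next (s k) \in s n.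
  elim: n => [//|n IH]; rewrite ltnS leq_eqVlt => /predU1P[->|kn].
    exact: mem_head.
  by rewrite inE IH ?orbT.
exists (fun n => (next (s n)).1), (fun n => (next (s n)).2); split=> [n|n|n k kn|n k nk].
- by have [] := nextP _ (sgood n).
- by have [] := nextP _ (sgood n).
- by have [_ _ + _ _] := nextP _ (sgood n); apply; exact: mem_s.
- have [_ _ _ _] := nextP _ (sgood k); apply.
  exact: (mem_s k.+1).
Qed.

End bidual.

(** The points [y] approximating [Phi] form a Cauchy sequence because the
    evaluations embed [E] isometrically; this is where completeness enters. *)
Lemma bidual_range_closed (R : realType) (E : completeNormedModType R)
    (Phi : dual_space (dual_space E)) :
  (forall e : R, 0 < e ->
    exists y : E, forall f, Phi f - f y <= e * `|f|) ->
  exists y : E, forall f, Phi f = f y.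
Proof.
move=> near_range.
have /choice[u uP] (n : nat) : exists y : E,
    forall f : dual_space E, Phi f - f y <= n.+1%:R^-1 * `|f|.
  by apply: near_range; rewrite invr_gt0 ltr0n.
have uP' n (f : dual_space E) : `|Phi f - f (u n)| <= n.+1%:R^-1 * `|f|.
  rewrite ler_norml uP andbT lerNl opprB.
  by have := uP n (- f); rewrite linearN normrN dualN opprK addrC.
have uD n m : `|u n - u m| <= n.+1%:R^-1 + m.+1%:R^-1.
  have [f f1 <-] := norming_functional (u n - u m).
  have invS k : k.+1%:R^-1 * `|f| <= k.+1%:R^-1 :> R.
    by rewrite ler_piMr// invr_ge0.
  have := uP' n f; have := uP' m f; have := invS n; have := invS m.
  rewrite !ler_norml dualBr => + + /andP[_ +] /andP[+ _].
  by move: (Phi f : R) (f (u n) : R) (f (u m) : R) `|f| n.+1%:R^-1 m.+1%:R^-1 => a b c d i j; lra.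
have ucvg : cvgn u.
  apply: cauchy_cvg; apply: cauchy_exP => e e0.
  have [N _ /(_ N (leqnn N)) /= Ne] := near_infty_natSinv_lt (PosNum (divr_gt0 e0 (ltr0n R 2))).
  exists (u N); near=> n; rewrite -ball_normE /=.
  apply: le_lt_trans (uD N n) _; rewrite [e]splitr ltrD//.
  by near: n; exact: (near_infty_natSinv_lt (PosNum (divr_gt0 e0 (ltr0n R 2)))).
exists (limn u) => f.
have fu : f (u n) @[n --> \oo] --> (Phi f : R).
  apply/cvgrPdist_le => e e0.
  have ef0 : 0 < e / (`|f| + 1) by rewrite divr_gt0// ltr_wpDl.
  near=> n; apply: le_trans (uP' n f) _.
  apply: (@le_trans _ _ (e / (`|f| + 1) * `|f|)).
    rewrite ler_wpM2r// ltW//; near: n.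
    exact: (near_infty_natSinv_lt (PosNum ef0)).
  by rewrite mulrAC ler_pdivrMr ?ltr_wpDl// ler_wpM2l ?(ltW e0)// lerDl.
apply: (cvg_unique _ fu) => //.
by apply: continuous_cvg => //; exact: dual_continuous.
Unshelve. all: by end_near. Qed.

(** * Stabilizing the distance to the cluster functionals *)

Section convex_hull.
Context (R : realType) (V : lmodType R).
Implicit Types S T : set V.

Definition hull S : set V :=
  [set h | forall C : set V, convex_set C -> S `<=` C -> C h].

Lemma sub_hull S : S `<=` hull S.
Proof. by move=> f Sf C _; apply. Qed.

Lemma hull_sub S C : convex_set C -> S `<=` C -> hull S `<=` C.
Proof. by move=> cC SC h; apply. Qed.

Lemma hull_convex S : convex_set (hull S).
Proof.
apply/convex_setP => x y t t0 t1 Sx Sy C cC SC.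
by move/convex_setP: (cC); apply=> //; [exact: Sx|exact: Sy].
Qed.

Lemma hull_mono S T : S `<=` T -> hull S `<=` hull T.
Proof.
by move=> ST; apply: hull_sub; [exact: hull_convex|exact: subset_trans (@sub_hull _)].
Qed.

Definition subspace T :=
  (forall x y, T x -> T y -> T (x + y)) /\ (forall (a : R) x, T x -> T (a *: x)).

Lemma subspace_convex T : subspace T -> convex_set T.
Proof. by move=> [TD TZ]; apply/convex_setP => *; apply: TD; exact: TZ. Qed.

End convex_hull.

Section stable_subsequence.
Context (R : realType) (E : normedModType R).
Local Notation D := (dual_space E).
Implicit Types (f g h w : D) (x : E) (K : set nat).

(** For a decreasing sequence of bounded sets [S], these are the points of the
    weak-* closed convex hulls of all the [S n], described by half-spaces. *)
Definition cluster_functionals (S : nat -> set D) : set D :=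
  [set w | forall x c n, (forall f, S n f -> f x <= c) -> w x <= c].

Lemma dual_norm_adherent g (e : R) :
  0 < e -> exists2 x, `|x| <= 1 & `|g| - e < g x.
Proof.
move=> e0; apply: contrapT => nox.
have : `|g| <= `|g| - e.
  apply: dual_norm_ball => x x1; rewrite leNgt; apply/negP => gx.
  by apply: nox; exists x.
lra.
Qed.

Variable F : nat -> D.
Hypothesis F1 : forall n, `|F n| <= 1.

Definition tail K (m : nat) : set D := F @` [set j | K j /\ (m <= j)%N].

(** Infinite sets of indices stand for subsequences. *)
Definition unbounded_index K := forall m, exists2 j, K j & (m <= j)%N.

Lemma cluster_tail_mono K K' : K' `<=` K ->
  cluster_functionals (tail K') `<=` cluster_functionals (tail K).
Proof.
move=> K'K w Ww x c n Kc; apply: (Ww x c n) => _ [j [K'j nj] <-].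
by apply: Kc; exists j => //; split => //; exact: K'K.
Qed.

Lemma cluster_tail_norm K w : cluster_functionals (tail K) w -> `|w| <= 1.
Proof.
move=> Ww; apply: dual_norm_ball => x x1; apply: (Ww x 1 0%N) => _ [j _ <-].
apply: le_trans (dual_ler_norm _ _) _.
by rewrite -[leRHS]mul1r ler_pM.
Qed.

(** Take [w1] almost maximizing the distance to [h], and [x1] almost norming
    [h - w1]. Infinitely many [F j] satisfy [F j x1 <= w1 x1 + e / 3]; keeping only
    these, every remaining cluster functional is at most this value at [x1], so
    its distance to [h] is almost maximal as well. *)
Lemma refine_index K h (e : R) : unbounded_index K -> 0 < e ->
  exists K', [/\ K' `<=` K, unbounded_index K' &
    forall w w', cluster_functionals (tail K') w ->
      cluster_functionals (tail K') w' -> `|h - w| <= `|h - w'| + e].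
Proof.
move=> Koo e0; pose W := cluster_functionals (tail K).
have [W0|/set0P/negP/negPn/eqP W0] := pselect (W !=set0); last first.
  by exists K; split=> // w w' Ww; have : W w by []; rewrite W0.
pose N := [set `|h - w| | w in W].
have supN : has_sup N.
  split; first by have [w Ww] := W0; exists `|h - w|, w.
  exists (`|h| + 1) => _ [w /cluster_tail_norm w1 <-].
  by apply: le_trans (ler_normB _ _) _; rewrite lerD2l.
have e30 : 0 < e / 3 by rewrite divr_gt0.
have [_ [w1 Ww1 <-] w1N] := sup_adherent e30 supN.
have [x1 x11 hx1] := dual_norm_adherent (h - w1) e30.
pose K' := [set j | K j /\ F j x1 <= w1 x1 + e / 3].
have K'K : K' `<=` K by move=> j [].
exists K'; split=> // [m|w w' /(cluster_tail_mono K'K) Ww W'w'].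
  apply: contrapT => noj.
  have : w1 (- x1) <= - (w1 x1 + e / 3).
    apply: (Ww1 (- x1) _ m) => _ [j [Kj mj] <-].
    rewrite dualNr lerN2; apply: ltW; rewrite ltNge; apply/negP => Fj.
    by apply: noj; exists j.
  by rewrite dualNr lerN2; lra.
have w'x1 : w' x1 <= w1 x1 + e / 3.
  by apply: (W'w' x1 _ 0%N) => _ [j [[_ Fj] _] <-].
have : `|h - w| <= sup N by apply: (sup_upper_bound supN); exists w.
have : (h - w') x1 <= `|h - w'|.
  by apply: le_trans (dual_ler_norm _ _) _; rewrite ler_piMr.
move: hx1 w1N; rewrite !dualB.
by move: (h x1 : R) (w1 x1 : R) (w' x1 : R) w'x1 => a b c; lra.
Qed.

(** Rational combinations, indexed by polynomials: a countable additive type whose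
    coefficients are the weights. *)
Let comb (q : {poly rat}) : D := \sum_(i < size q) ratr q`_i *: F i.

Let combE (q : {poly rat}) n :
  (size q <= n)%N -> comb q = \sum_(i < n) ratr q`_i *: F i.
Proof.
move=> qn; rewrite /comb (big_ord_widen n (fun i => ratr q`_i *: F i))//.
rewrite big_mkcond; apply: eq_bigr => i _; case: ltnP => // qi.
by rewrite nth_default// rmorph0 scale0r.
Qed.

Let combD p q : comb (p + q) = comb p + comb q.
Proof.
pose n := maxn (size p) (size q).
rewrite (@combE p n) ?leq_maxl// (@combE q n) ?leq_maxr//.
rewrite (@combE (p + q) n) ?size_polyD// -big_split; apply: eq_bigr => i _.
by rewrite coefD rmorphD scalerDl.
Qed.

Let combZ (a : rat) q : comb (a *: q) = ratr a *: comb q.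
Proof.
rewrite (@combE (a *: q) (size q)) ?size_scale_leq// scaler_sumr.
by apply: eq_bigr => i _; rewrite coefZ rmorphM scalerA.
Qed.

Let combX n : comb 'X^n = F n.
Proof.
rewrite /comb size_polyXn big_ord_recr /= coefXn eqxx rmorph1 scale1r.
by rewrite big1 ?add0r// => i _; rewrite coefXn ltn_eqF ?ltn_ord// rmorph0 scale0r.
Qed.

(** Diagonal argument. The index set is refined successively for all pairs of a
    rational combination of the [F n] and a tolerance; the sets [S n] are the
    tails of the resulting subsequence. The equality of distances extends by
    continuity to the closure [T] of the rational combinations. *)
Lemma stable_subsequence : exists (S : nat -> set D) (T : set D),
  [/\ forall n, [/\ S n !=set0, S n.+1 `<=` S n & S n `<=` F @` [set j | (n <= j)%N]],
      subspace T, range F `<=` T &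
      forall h w w', T h -> cluster_functionals S w -> cluster_functionals S w' ->
        `|h - w| = `|h - w'|].
Proof.
have /choice[next nextP] (p : set nat * (D * nat)) : exists K', unbounded_index p.1 ->
  [/\ K' `<=` p.1, unbounded_index K' &
    forall w w', cluster_functionals (tail K') w ->
      cluster_functionals (tail K') w' ->
      `|p.2.1 - w| <= `|p.2.1 - w'| + p.2.2.+1%:R^-1].
  have [Koo|] := pselect (unbounded_index p.1); last by exists set0.
  have [|K' K'P] := @refine_index p.1 p.2.1 p.2.2.+1%:R^-1 Koo.
    by rewrite invr_gt0.
  by exists K'.
pose K_ := fix K_ n := if n is k.+1 then
  if @unpickle ({poly rat} * nat)%type k is Some (q, m) then next (K_ k, (comb q, m))
  else K_ k else setT.
have K_oo n : unbounded_index (K_ n).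
  elim: n => [m|n IH] /=; first by exists m.
  by case: unpickle => [[q m]|]//; have [] := nextP (K_ n, (comb q, m)) IH.
have K_S n : K_ n.+1 `<=` K_ n.
  rewrite /=; case: unpickle => [[q m]|]//.
  by have [] := nextP (K_ n, (comb q, m)) (K_oo n).
pose S n := tail (K_ n) n.
have K_le m n : (m <= n)%N -> K_ n `<=` K_ m.
  elim: n => [|n IH]; first by rewrite leqn0 => /eqP ->.
  rewrite leq_eqVlt => /predU1P[->//|/IH]; exact: subset_trans.
have WS k : cluster_functionals S `<=` cluster_functionals (tail (K_ k)).
  move=> w Sw x c n kc; apply: (Sw x c (maxn k n)) => _ [j [Kj nj] <-].
  apply: kc; exists j => //; split.
    by apply: K_le Kj; exact: leq_maxl.
  by apply: leq_trans nj; exact: leq_maxr.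
pose T := [set h | forall e : R, 0 < e -> exists q, `|h - comb q| <= e].
exists S, T; split.
- move=> n; split.
  + by have [j Kj nj] := K_oo n n; exists (F j), j.
  + move=> _ [j [Kj nj] <-]; exists j => //; split; first exact: K_S.
    exact: ltnW.
  + by move=> _ [j [Kj nj] <-]; exists j.
- split=> [g h Tg Th e e0|a h Th e e0].
    have [q gq] := Tg (e / 2) ltac:(lra); have [r hr] := Th (e / 2) ltac:(lra).
    exists (q + r); rewrite combD opprD addrACA.
    by apply: le_trans (ler_normD _ _) _; lra.
  have h10 : 0 < `|h| + 1 by rewrite ltr_wpDl.
  have d0 : 0 < e / 2 / (`|h| + 1) by rewrite divr_gt0//; lra.
  have [|b] := @rat_in_itvoo _ a (a + e / 2 / (`|h| + 1)); first by rewrite ltrDl.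
  rewrite in_itv /= => /andP[ab ba].
  have b10 : 0 < `|ratr b| + 1 :> R by rewrite ltr_wpDl.
  have [|q hq] := Th (e / 2 / (`|ratr b| + 1)); first by rewrite divr_gt0//; lra.
  exists (b *: q); rewrite combZ.
  have -> : a *: h - ratr b *: comb q = (a - ratr b) *: h + ratr b *: (h - comb q).
    by rewrite scalerBl scalerBr addrA subrK.
  apply: le_trans (ler_normD _ _) _; rewrite (normrZ (a - ratr b)) (normrZ (ratr b)) [leRHS]splitr lerD//.
    apply: (@le_trans _ _ (e / 2 / (`|h| + 1) * (`|h| + 1))); last by rewrite divfK ?gt_eqF.
    apply: ler_pM => //; last by rewrite lerDl.
    by rewrite ler_norml; lra.
  rewrite ler_pdivlMr// in hq; rewrite mulrC; apply: le_trans hq.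
  by rewrite ler_wpM2l// lerDl.
- move=> _ [n _ <-] e e0; exists 'X^n.
  by rewrite combX subrr normr0 ltW.
- have le_q q w w' : cluster_functionals S w -> cluster_functionals S w' ->
      `|comb q - w| <= `|comb q - w'|.
    move=> Sw Sw'; apply/ler_addgt0Pr => e e0.
    have [m _ /(_ m (leqnn m)) /= me] := near_infty_natSinv_lt (PosNum e0).
    pose k := pickle (q, m).
    have [_ _] := nextP (K_ k, (comb q, m)) (K_oo k).
    have -> : next (K_ k, (comb q, m)) = K_ k.+1 by rewrite /= pickleK.
    move=> /(_ w w' (WS _ _ Sw) (WS _ _ Sw')) /= /le_trans; apply.
    by rewrite lerD2l ltW.
  have le_T h w w' : T h -> cluster_functionals S w -> cluster_functionals S w' ->
      `|h - w| <= `|h - w'|.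
    move=> Th Sw Sw'; apply/ler_addgt0Pr => e e0.
    have [q hq] := Th (e / 2) ltac:(lra).
    have := le_q q _ _ Sw Sw'.
    have := ler_distD (comb q) h w; have := ler_distD h (comb q) w'.
    rewrite (distrC (comb q) h); lra.
  by move=> h w w' Th Sw Sw'; apply/eqP; rewrite eq_le !le_T.
Qed.

End stable_subsequence.

(** * A functional that does not attain its norm *)

Section james.
Context (R : realType) (E : normedModType R).
Local Notation D := (dual_space E).

(** The norm is convex along the segment from [v] to [v + (b + b') *: (a' - w)],
    for [a'] the weighted mean of [g] and [a]. If [g] almost minimizes the norm of
    [v + b *: (g - w)] over [A], the growth rate beyond that point is at least the
    average rate before it, which exceeds [r]. So the strict growth can be
    continued with any next weight [b']. *)
Lemma convex_extrapolation (V : normedModType R) (A : set V) (v w : V) (b b' r c : R) :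
  convex_set A -> A !=set0 -> 0 < b -> 0 < b' -> `|v| + b * r < c ->
  (forall a, A a -> c <= `|v + b *: (a - w)|) ->
  exists2 g, A g & exists2 c', `|v + b *: (g - w)| + b' * r < c' &
    forall a, A a -> c' <= `|v + b *: (g - w) + b' *: (a - w)|.
Proof.
move=> cA [a0 Aa0] b0 b'0 vc cA_.
pose N := [set `|v + b *: (a - w)| | a in A].
have infN : has_inf N.
  split; first by exists `|v + b *: (a0 - w)|, a0.
  by exists c => _ [a Aa <-]; exact: cA_.
have cN : c <= inf N by apply: lb_le_inf infN.1 _ => _ [a Aa <-]; exact: cA_.
pose q := (inf N - `|v|) / b.
have rq : r < q by rewrite /q ltr_pdivlMr// mulrC; lra.
have d0 : 0 < b' * (q - r) by rewrite mulr_gt0// subr_gt0.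
have [_ [g Ag <-] gN] := inf_adherent d0 infN.
exists g => //; exists (inf N + b' * q); first by move: gN; rewrite mulrBr; lra.
move=> a Aa; have [a' Aa' a'E] := convex_set_combination cA (ltW b0) (ltW b'0) Ag Aa.
have Na' : inf N <= `|v + b *: (a' - w)| by apply: ge_inf infN.2 _ _; exists a'.
set X := v + b *: (g - w) + b' *: (a - w).
have XE : (b + b') *: (v + b *: (a' - w)) = b *: X + b' *: v.
  have aE : (b + b') *: (a' - w) = b *: (g - w) + b' *: (a - w).
    by rewrite scalerBr a'E scalerDl opprD addrACA -!scalerBr.
  by rewrite scalerDr scalerA mulrC -scalerA aE /X -addrA (scalerDr b v) scalerDl addrAC.
have : (b + b') * inf N <= b * `|X| + b' * `|v|.
  apply: le_trans (_ : (b + b') * `|v + b *: (a' - w)| <= _).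
    by rewrite ler_wpM2l// ltW// addr_gt0.
  rewrite -[X in X * _]gtr0_norm ?addr_gt0// -normrZ XE.
  by apply: le_trans (ler_normD _ _) _; rewrite !normrZ !gtr0_norm.
have qE : b * q = inf N - `|v| by rewrite /q mulrC divfK ?gt_eqF.
move=> NX; rewrite -(ler_pM2l b0) mulrDr (mulrCA b b') qE; lra.
Qed.

Lemma hull_halfspace (S : set D) (x : E) (c : R) :
  (forall f, S f -> f x <= c) -> forall f, hull S f -> f x <= c.
Proof.
move=> Sc; apply: (@hull_sub R D S [set f | f x <= c]) => //.
apply/convex_setP => f g t t0 t1 /= fc gc.
change (t * f x + (1 - t) * g x <= c).
have -> : c = t * c + (1 - t) * c by ring.
by apply: lerD; rewrite ler_wpM2l// subr_ge0.
Qed.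

Lemma block_cluster (S : nat -> set D) (g : nat -> D) (w : D) :
  (forall n, S n.+1 `<=` S n) -> (forall n, hull (S n) (g n)) ->
  (forall x c, (\forall n \near \oo, g n x <= c) -> w x <= c) ->
  cluster_functionals S w.
Proof.
move=> Sdecr gS wg x c n Sc; apply: wg; exists n => // m /= nm.
have SS : S m `<=` S n.
  elim: m nm => [|m IH]; first by rewrite leqn0 => /eqP ->.
  rewrite leq_eqVlt => /predU1P[->//|/IH]; exact: subset_trans.
by apply: (hull_halfspace (S := S n)) => //; exact: hull_mono SS _ (gS m).
Qed.

Lemma hull_ball (S : set D) : (forall f, S f -> `|f| <= 1) ->
  forall f, hull S f -> `|f| <= 1.
Proof.
move=> S1 f Sf; apply: dual_norm_ball => x x1; apply: hull_halfspace Sf => g Sg.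
apply: le_trans (dual_ler_norm _ _) _.
by rewrite -[leRHS]mul1r ler_pM// S1.
Qed.

Definition block_sum (rho : R) (g : nat -> D) (w : D) n : D :=
  \sum_(i < n) rho ^+ i *: (g i - w).

Lemma block_sumS rho g w n :
  block_sum rho g w n.+1 = block_sum rho g w n + rho ^+ n *: (g n - w).
Proof. by rewrite /block_sum big_ord_recr. Qed.

(** Up to a positive factor, the block sum is [h - w] for a mean [h] of the blocks,
    so its norm inherits the independence of [w]. *)
Lemma block_sum_norm rho g w w' n (T : set D) :
  0 < rho -> subspace T -> (forall i, T (g i)) ->
  (forall h, T h -> `|h - w| = `|h - w'|) ->
  `|block_sum rho g w n| = `|block_sum rho g w' n|.
Proof.
move=> rho0 [TD TZ] Tg Tww'; case: n => [|n]; first by rewrite /block_sum !big_ord0.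
pose B := \sum_(i < n.+1) rho ^+ i.
pose s := \sum_(i < n.+1) rho ^+ i *: g i.
have B0 : 0 < B.
  rewrite /B big_ord_recl expr0 ltr_wpDr// sumr_ge0// => i _.
  by rewrite exprn_ge0// ltW.
have sumE u : block_sum rho g u n.+1 = B *: (B^-1 *: s - u).
  rewrite scalerBr scalerA divff ?gt_eqF// scale1r scaler_suml -sumrB.
  by apply: eq_bigr => i _; rewrite scalerBr.
have Ts : T s.
  rewrite /s; apply: big_ind => [||i _]; [|exact: TD|exact: TZ].
  by rewrite -(scale0r (g 0%N)); exact: TZ.
by rewrite !sumE !normrZ Tww'//; exact: TZ.
Qed.

(** The blocks are selected with an arbitrary cluster functional [w0], and the sum
    [G] is formed with a cluster functional [w] of the blocks, which is known only
    afterwards. Stability makes the norms of the partial sums the same for both.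
    If [G] attained its norm at [x0], comparing the partial sums of orders [n] and
    [n.+1] at [x0] would give [w x0 + r / 2 <= g n x0] for all [n], whereas [w x0]
    is a cluster value of [g n x0]. *)
Lemma james_nonattaining (F : nat -> D) (S : nat -> set D) (T : set D) (theta : R) :
  (forall n, `|F n| <= 1) -> 0 < theta ->
  (forall n, [/\ S n !=set0, S n.+1 `<=` S n & S n `<=` range F]) ->
  subspace T -> range F `<=` T ->
  (forall h w w', T h -> cluster_functionals S w -> cluster_functionals S w' ->
    `|h - w| = `|h - w'|) ->
  (forall a w, hull (range F) a -> cluster_functionals S w -> theta <= `|a - w|) ->
  exists G : D, forall x : E, `|x| <= 1 -> G x < `|G|.
Proof.
move=> F1 theta0 SP subT FT Tstable far.
have Sdecr n : S n.+1 `<=` S n by have [] := SP n.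
have S1 n f : hull (S n) f -> `|f| <= 1.
  apply: hull_ball => {}f Sf; have [_ _ SF] := SP n.
  by have [j _ <-] := SF _ Sf.
have hullF n : hull (S n) `<=` hull (range F) by apply: hull_mono; have [] := SP n.
have hullT n f : hull (S n) f -> T f.
  by move=> /hullF; apply: hull_sub => //; exact: subspace_convex.
have /choice[f0 f0S] n : exists f, S n f by have [] := SP n.
have [|w0 _ w0f] := @cluster_functional _ _ f0 1.
  by move=> n; apply: (S1 n); apply: sub_hull; exact: f0S.
have Sw0 : cluster_functionals S w0.
  by apply: (block_cluster Sdecr _ w0f) => n; apply: sub_hull; exact: f0S.
pose r := theta / 2; have r0 : 0 < r by rewrite divr_gt0.
(* C = 2 / (1 - rho), so that rho ^+ n * C bounds the tail of the series from
   order n on; rho is such that the tail after n is a quarter of rho ^+ n * r. *)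
pose rho := r / (8 + r); pose C := (8 + r) / 4.
have C0 : 0 < C by rewrite divr_gt0// addr_gt0.
have rho0 : 0 < rho by rewrite divr_gt0// addr_gt0.
have rhoC : rho * C = r / 4 by rewrite /rho /C mulrA divfK// gt_eqF// addr_gt0.
have rhoX n : 0 < rho ^+ n by rewrite exprn_gt0.
(* The invariant of the construction, v being the partial sum of order n. *)
pose I n (v : D) := exists2 c, `|v| + rho ^+ n * r < c &
  forall a, hull (S n) a -> c <= `|v + rho ^+ n *: (a - w0)|.
have I0 : I 0%N 0.
  exists theta; first by rewrite normr0 expr0 add0r mul1r /r; lra.
  by move=> a /hullF Fa; rewrite expr0 scale1r add0r far.
have /choice[next nextP] (p : nat * D) : exists g, I p.1 p.2 ->
    hull (S p.1) g /\ I p.1.+1 (p.2 + rho ^+ p.1 *: (g - w0)).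
  case: p => n v /=; have [[c vc cA]|] := pselect (I n v); last by exists 0.
  have [|g Sg [c' gc' c'P]] :=
    @convex_extrapolation _ (hull (S n)) v w0 _ (rho ^+ n.+1) r c
      (@hull_convex _ _ (S n)) _ (rhoX n) (rhoX n.+1) vc cA.
    by have [[f Sf] _ _] := SP n; exists f; exact: sub_hull.
  exists g => _; split => //; exists c' => // a Sa; apply: c'P.
  exact: (hull_mono (Sdecr n) Sa).
pose v := fix v n : D := if n is k.+1 then v k + rho ^+ k *: (next (k, v k) - w0) else 0.
have Iv n : I n (v n) by elim: n => [|n IH] //=; have [] := nextP (n, v n) IH.
pose g n := next (n, v n).
have gS n : hull (S n) (g n) by have [] := nextP (n, v n) (Iv n).
have vE n : v n = block_sum rho g w0 n.
  elim: n => [|n IH]; first by rewrite /block_sum big_ord0.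
  by rewrite block_sumS -IH.
have [|w w1 wg] := @cluster_functional _ _ g 1; first by move=> n; exact: S1 (gS n).
have Sw : cluster_functionals S w by exact: block_cluster Sdecr gS wg.
pose V := block_sum rho g w.
have Vv n : `|V n| = `|v n|.
  rewrite vE; apply: (block_sum_norm n rho0 subT) => [i|h Th]; first exact: hullT (gS i).
  exact: Tstable.
have Vgrow n : `|V n| + rho ^+ n * r < `|V n.+1|.
  rewrite !Vv; have [c vc /(_ _ (gS n)) gc] := Iv n.
  exact: lt_le_trans gc.
have Vtail n k : `|V (n + k)%N - V n| <= rho ^+ n * C - rho ^+ (n + k) * C.
  elim: k => [|k IH]; first by rewrite addn0 !subrr normr0.
  rewrite addnS /V block_sumS -/(V _) addrAC.
  apply: le_trans (ler_normD _ _) _; rewrite normrZ gtr0_norm//.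
  have : `|g (n + k)%N - w| <= 2.
    by apply: le_trans (ler_normB _ _) _; have := S1 _ _ (gS (n + k)%N); lra.
  move=> /(ler_wpM2l (ltW (rhoX (n + k)%N))); rewrite exprSr -mulrA rhoC.
  have : rho ^+ (n + k) * C = rho ^+ (n + k) * 2 + rho ^+ (n + k) * (r / 4).
    by rewrite -mulrDr; congr (_ * _); rewrite /C; lra.
  move: IH; lra.
have Vle n m x : (n <= m)%N -> V m x <= V n x + rho ^+ n * C * `|x|.
  move=> nm; rewrite -lerBlDl -dualB; apply: le_trans (dual_ler_norm _ _) _.
  rewrite ler_wpM2r// -(subnKC nm); apply: le_trans (Vtail _ _) _.
  by rewrite gerBl mulr_ge0// ltW.
have [|G _ GV] := @cluster_functional _ _ V C.
  move=> n; have := Vtail 0%N n; rewrite add0n /V {2}/block_sum big_ord0 subr0.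
  move=> /le_trans; apply; rewrite expr0 mul1r gerBl mulr_ge0// ltW//.
have GVle n x : G x <= V n x + rho ^+ n * C * `|x|.
  by apply: GV; exists n => // m; exact: Vle.
exists G => x0 x01; rewrite ltNge; apply/negP => Gx0.
have key n : w x0 + r / 2 <= g n x0.
  have x0C k : rho ^+ k * C * `|x0| <= rho ^+ k * C.
    by rewrite ler_piMr// mulr_ge0// ltW.
  have VG : `|V n.+1| <= `|G| + rho ^+ n.+1 * C.
    apply: dual_norm_ball => x x1.
    have := GVle n.+1 (- x); rewrite !dualNr normrN.
    have := dual_ler_norm G x.
    have : `|G| * `|x| <= `|G| by rewrite ler_piMr.
    have : rho ^+ n.+1 * C * `|x| <= rho ^+ n.+1 * C.
      by rewrite ler_piMr// mulr_ge0// ltW.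
    move: (G x : R) (V n.+1 x : R) => a b; lra.
  have Vx0 : V n x0 <= `|V n|.
    by apply: le_trans (dual_ler_norm _ _) _; rewrite ler_piMr.
  have VS : V n.+1 x0 = V n x0 + rho ^+ n * (g n x0 - w x0) by rewrite /V block_sumS.
  have := GVle n.+1 x0; have := Vgrow n; have := x0C n.+1; rewrite VS.
  have rC : rho ^+ n.+1 * C = rho ^+ n * (r / 4) by rewrite exprSr -mulrA rhoC.
  rewrite rC in VG *; move=> x0n Vn Gn; rewrite -(ler_pM2l (rhoX n)).
  move: VG Vx0 Gx0 x0n Vn Gn.
  by move: (G x0 : R) (V n x0 : R) (g n x0 : R) (w x0 : R) => a b c d; lra.
have := wg (- x0) (- (w x0 + r / 2)).
rewrite dualNr lerN2 => H; have : w x0 + r / 2 <= w x0.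
  by apply: H; apply: nearW => n; rewrite dualNr lerN2.
lra.
Qed.

End james.

(** * James' theorem *)

(** A convex combination of the [F n] takes at [x m], for [m] large, a value at
    least [theta / 2], where all cluster functionals are at most zero: this is the
    distance needed by [james_nonattaining]. *)
Lemma james (R : realType) (E : completeNormedModType R) :
  (forall g : dual_space E, exists2 x0 : E, `|x0| <= 1 & g x0 = `|g|) ->
  reflexive_space E.
Proof.
move=> attain Phi; apply: contrapT => nPhi.
have [theta theta0 far] : exists2 theta : R, 0 < theta &
    ~ exists y : E, forall f, Phi f - f y <= theta * `|f|.
  apply: contrapT => near_range; apply/nPhi/bidual_range_closed => e e0.
  by apply: contrapT => far; apply: near_range; exists e.
have [F [x [F1 xPhi Flow Fhigh]]] := biorthogonal_sequences theta0 far.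
have [S [T [SP subT FT Tstable]]] := stable_subsequence F1.
have Phi1 : 0 < `|Phi| + 1 by rewrite ltr_wpDl.
have [|||G Gx] := @james_nonattaining R E F S T (theta / 2 / (`|Phi| + 1)) F1 _ _
    subT FT Tstable; last by have [x0 /Gx + Gx0] := attain G; rewrite Gx0 ltxx.
- by rewrite !divr_gt0.
- move=> n; have [Sn0 Sdecr SF] := SP n; split=> //.
  by move=> _ /SF[j _ <-]; exists j.
- move=> a w Fa Sw.
  have [m am] : [set b : dual_space E | exists m, forall k, (m <= k)%N ->
      theta / 2 <= b (x k)] a.
    move: a Fa; apply: hull_sub => [|_ [n _ <-]]; last by exists n => k; exact: Fhigh.
    apply/convex_setP => b c t t0 t1 [m bm] [n cn]; exists (maxn m n) => k.
    rewrite geq_max => /andP[mk nk].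
    change (theta / 2 <= t * b (x k) + (1 - t) * c (x k)).
    have -> : theta / 2 = t * (theta / 2) + (1 - t) * (theta / 2) by ring.
    by apply: lerD; rewrite ler_wpM2l ?subr_ge0// ?bm ?cn.
  have wm : w (x m) <= 0.
    apply: (Sw _ _ m.+1) => _ /(let: And3 _ _ SF := SP m.+1 in SF _) [j mj <-].
    by rewrite Flow.
  rewrite ler_pdivrMr//; apply: (@le_trans _ _ ((a - w) (x m))).
    rewrite dualB; have := am m (leqnn m); move: wm.
    by move: (a (x m) : R) (w (x m) : R) => p q; lra.
  apply: le_trans (dual_ler_norm _ _) _; rewrite ler_wpM2l//.
  by apply: le_trans (xPhi m) _; rewrite lerDl.
Qed.

(** * Minimization in reflexive spaces *)

Section minimization.
Context (R : realType) (E : normedModType R).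
Implicit Types (A : set E) (f : E -> \bar R).
Local Open Scope ereal_scope.

Lemma bounded_setP (V : normedModType R) (A : set V) :
  bounded_set A <-> exists M : R, forall x, A x -> (`|x| <= M)%R.
Proof.
split=> [[M [_ MA]]|[M MA]]; first by exists (M + 1)%R; apply: MA; rewrite ltrDl.
exists M; split; first exact: num_real.
by move=> N MN x /MA xM; apply: le_trans xM (ltW MN).
Qed.

Lemma attains_inf_le A f :
  attains_inf A f -> exists2 x0, A x0 & forall y, A y -> f x0 <= f y.
Proof.
move=> [x0 Ax0 fx0]; exists x0 => // y Ay; rewrite fx0.
by apply: ereal_inf_lbound; exists y.
Qed.

Lemma sublevel_limit A f (a : \bar R) (u : nat -> E) (x : E) :
  closed A -> lsc_on A f -> (forall n, A (u n)) -> (forall n, f (u n) <= a) ->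
  (forall n, (`|u n - x| <= n.+1%:R^-1)%R) -> A x /\ f x <= a.
Proof.
move=> clA lscf Au fu ux.
have u0 : (`|u n - x| @[n --> \oo] --> (0 : R))%R.
  apply/cvgrPdist_le => e e0; near=> n.
  rewrite sub0r normrN normr_id; apply: le_trans (ux n) _; apply: ltW.
  by near: n; exact: (near_infty_natSinv_lt (PosNum e0)).
have Ax : A x.
  apply: (@closed_cvg _ _ \oo _ u A clA _ x); first exact: nearW.
  apply/cvgrPdist_le => e e0; move/cvgrPdist_le: u0 => /(_ e e0).
  by apply: filterS => n; rewrite sub0r normrN normr_id distrC.
split => //; apply: le_trans (lscf x u Ax Au u0) _.
rewrite limn_einf_lim; apply: lime_le; first exact: is_cvg_einfs.
apply: nearW => n; apply: le_trans (fu n).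
by apply: ereal_inf_lbound; exists n => /=.
Unshelve. all: by end_near. Qed.

Lemma sublevel_convex A f (a : R) : convex_set A -> convex_on A f ->
  convex_set [set x | A x /\ f x <= a%:E].
Proof.
move=> /convex_setP cA cf; apply/convex_setP => x y t t0 t1 [Ax fx] [Ay fy].
split; first exact: cA.
apply: le_trans (cf x y t Ax Ay _) _; first by rewrite t0.
have -> : a%:E = t%:E * a%:E + (1 - t)%:E * a%:E.
  by rewrite -!EFinM -EFinD; congr EFin; ring.
by apply: leeD; apply: lee_wpmul2l; rewrite ?lee_fin ?subr_ge0.
Qed.

Lemma ereal_le_of_real_bounds (x y : \bar R) : x < +oo ->
  (forall a : R, x < a%:E -> y <= a%:E) -> y <= x.
Proof.
case: x => [r| |] //= _ H.
  apply/lee_addgt0Pr => e e0; rewrite -EFinD; apply: H.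
  by rewrite lte_fin ltrDl.
case: y H => [s| |//] H.
  by have := H (s - 1)%R (ltNyr (s - 1)%R); rewrite lee_fin leNgt gtrBl ltr01.
by have := H 0%R (ltNyr 0%R); rewrite leNgt ltry.
Qed.

(** The constraints [g u <= c] for [u] in some sublevel set [L a] are consistent,
    and a functional on the dual obeying all of them is, by reflexivity, the
    evaluation at a point [x]. For each level [a] above the infimum, separating
    [x] from the sublevel set would contradict one of the constraints. *)
Lemma reflexive_attains_inf A f (M : R) : reflexive_space E ->
  closed A -> convex_set A -> proper_on A f -> lsc_on A f -> convex_on A f ->
  (forall a : R, ereal_inf (f @` A) < a%:E ->
    exists u, [/\ A u, (`|u| <= M)%R & f u <= a%:E]) ->
  attains_inf A f.
Proof.
move=> reflE clA cvxA [p0 Ap0 fp0] lscf cvxf nearmin.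
set I := ereal_inf (f @` A) in nearmin.
have Ifin : I < +oo by apply: le_lt_trans fp0; apply: ereal_inf_lbound; exists p0.
have [a0 Ia0] : exists a0 : R, I < a0%:E.
  case: (I) Ifin => [r| |] // _; first by exists (r + 1)%R; rewrite lte_fin ltrDl.
  by exists 0%R; exact: ltNyr.
pose L (a : R) := [set u | [/\ A u, (`|u| <= M)%R & f u <= a%:E]].
have M0 : (0 <= M)%R by have [u [_ uM _]] := nearmin a0 Ia0; apply: le_trans uM.
have Lmin a b : L (Num.min a b) `<=` L a `&` L b.
  by move=> u [Au uM fu]; split; split=> //; apply: le_trans fu _;
    rewrite lee_fin ge_min lexx ?orbT.
pose K := [set p : dual_space E * R | exists2 a : R, I < a%:E &
  forall u, L a u -> (p.1 u <= p.2)%R].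
have [||g|Psi _ PsiK] := @hahn_banach_dual R (dual_space E) K M.
- split=> [g c h d [a Ia /= ga] [b Ib /= hb]|t g c t0 [a Ia /= ga]|c [a Ia /= ca]].
  + exists (Num.min a b) => [|u /Lmin[/ga gu /hb hu]] /=.
      by rewrite EFin_min lt_min Ia Ib.
    exact: lerD.
  + by exists a => // u /ga gu; apply: ler_wpM2l.
  + by have [u /ca] := nearmin a Ia.
- exact: M0.
- exists (M * `|g|)%R => //; exists a0 => // u [_ uM _] /=.
  by rewrite mulrC; apply: le_trans (dual_ler_norm _ _) _; rewrite ler_wpM2l.
have [x Psix] := reflE Psi.
have xL a : I < a%:E -> A x /\ f x <= a%:E.
  move=> Ia; have [u [Au _ fu]] := nearmin a Ia.
  have [[r r0 far]|close] := pselect (exists2 r : R, (0 < r)%R &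
      forall y, A y /\ f y <= a%:E -> (r <= `|y - x|)%R).
    have [|g _ gsep] := separation (sublevel_convex cvxA cvxf) _ far; first by exists u.
    have : (Psi (- g) <= - (g x + r))%R.
      apply: PsiK; exists a => // y [Ay _ fy].
      by change (- g y <= - (g x + r))%R; rewrite lerN2; apply: gsep.
    by rewrite dualNr Psix lerN2 gerDl leNgt r0.
  have /choice[v vP] (n : nat) : exists y, [/\ A y, f y <= a%:E & (`|y - x| <= n.+1%:R^-1)%R].
    apply: contrapT => nov; apply: close; exists n.+1%:R^-1%R; first by rewrite invr_gt0.
    move=> y [Ay fy]; rewrite leNgt; apply/negP => yx.
    by apply: nov; exists y; split=> //; exact: ltW.
  by apply: (sublevel_limit clA lscf (u := v)) => n; have [] := vP n.
exists x; first by have [] := xL a0 Ia0.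
apply/eqP; rewrite eq_le; apply/andP; split.
  by apply: ereal_le_of_real_bounds => // a /xL[].
by apply: ereal_inf_lbound; exists x => //; have [] := xL a0 Ia0.
Qed.

Lemma reflexive_coercive_attains_inf A f : reflexive_space E ->
  closed A -> convex_set A -> proper_on A f -> lsc_on A f -> convex_on A f ->
  (forall M : R, exists r : R, forall x, A x -> (r < `|x|)%R -> M%:E < f x) ->
  attains_inf A f.
Proof.
move=> reflE clA cvxA pf lscf cvxf coer; have [p0 Ap0 fp0] := pf.
have [m fm] : exists m : R, f p0 < m%:E.
  case: (f p0) fp0 => [r| |] // _; first by exists (r + 1)%R; rewrite lte_fin ltrDl.
  by exists 0%R; exact: ltNyr.
have [r rP] := coer m.
have small u : A u -> f u <= m%:E -> (`|u| <= r)%R.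
  by move=> Au fu; rewrite leNgt; apply/negP => /(rP _ Au); rewrite ltNge fu.
apply: (reflexive_attains_inf (M := r)) => // a /ereal_inf_lt[_ [u Au <-] fu].
have [fum|fum] := leP (f u) m%:E.
  by exists u; split=> //; [exact: small|exact: ltW].
exists p0; split=> //; first by apply: small => //; exact: ltW.
by apply/ltW/(lt_trans fm)/(lt_trans fum).
Qed.

Lemma lipschitz_lsc (f : E -> R) (k : R) :
  (forall x y, `|f x - f y| <= k * `|x - y|)%R -> lsc_on setT (EFin \o f).
Proof.
move=> fk x u _ _ ux.
have fu : (EFin \o f) (u n) @[n --> \oo] --> (f x)%:E.
  apply: cvg_EFin; first exact: nearW.
  apply/cvgrPdist_le => e e0.
  have d0 : (0 < e / (`|k| + 1))%R by rewrite divr_gt0// ltr_wpDl.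
  move/cvgrPdist_le: ux => /(_ _ d0); apply: filterS => n.
  rewrite sub0r normrN normr_id ler_pdivlMr ?ltr_wpDl// => un.
  rewrite distrC; apply: le_trans (fk _ _) _; apply: le_trans un.
  rewrite mulrC ler_wpM2l//; apply: le_trans (ler_norm k) _.
  by rewrite lerDl.
by have [-> _] := cvg_limn_einf_sup fu.
Qed.

Lemma lipschitz_setTP (f : E -> R) :
  [lipschitz f x | x in setT] <->
  exists k : R, forall x y, (`|f x - f y| <= k * `|x - y|)%R.
Proof.
split=> [[k [_ fk]]|[k fk]].
  exists (k + 1)%R => x y; have := fk (k + 1)%R; rewrite ltrDl => /(_ ltr01).
  by move=> /(_ (x, y)); apply.
exists k; split=> [|l kl [x y] _ /=]; first exact: num_real.
by apply: le_trans (fk x y) _; rewrite ler_wpM2r// ltW.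
Qed.

(** Any sequence of values converging to the infimum becomes nonincreasing when
    each point is kept until a better one comes. *)
Lemma minimizing_sequence_exists A f :
  proper_on A f -> exists u, minimizing_sequence A f u.
Proof.
move=> [p0 Ap0 _].
have [|v vA vI] := @ereal_inf_seq R (f @` A).
  by apply/set0P; exists (f p0), p0.
have /choice[w wP] n : exists x, A x /\ f x = v n by have [x] := vA n; exists x.
pose u := fix u n : E := if n is k.+1 then
  if f (w k.+1) <= f (u k) then w k.+1 else u k else w 0%N.
have Au n : A (u n).
  elim: n => [|n IH] /=; first by have [] := wP 0%N.
  by case: ifP => // _; have [] := wP n.+1.
have uw n : f (u n) <= f (w n).
  case: n => [//|n] /=; case: ifP => [//|/negbT]; rewrite -ltNge; exact: ltW.
exists u; split=> //.
- apply/nonincreasing_seqP => n /=.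
  by case: ifP.
- apply: (squeeze_cvge _ (cvg_cst _) vI); apply: nearW => n.
  have [_ <-] := wP n; rewrite uw andbT.
  by apply: ereal_inf_lbound; exists (u n).
Qed.

End minimization.

(** * Norm attainment as a minimization problem *)

Section unit_ball.
Context (R : realType) (E : normedModType R).

Lemma unit_ball_closed : closed [set x : E | `|x| <= 1].
Proof.
apply: (@closed_comp _ _ (fun x : E => `|x|) [set r : R | r <= 1]).
  by move=> x _; exact: norm_continuous.
exact: closed_le.
Qed.

Lemma unit_ball_convex : convex_set [set x : E | `|x| <= 1].
Proof.
apply/convex_setP => x y t t0 t1 /= x1 y1.
have t1' : 0 <= 1 - t by rewrite subr_ge0.
apply: le_trans (ler_normD _ _) _; rewrite !normrZ !ger0_norm//.
have := ler_wpM2l t0 x1; have := ler_wpM2l t1' y1; lra.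
Qed.

Lemma dual_opp_lsc (g : dual_space E) : lsc_on setT (fun x => (- g x)%:E).
Proof.
apply: (lipschitz_lsc (f := fun x => - g x) (k := `|g|)) => x y.
have H a b : - g a - - g b <= `|g| * `|a - b|.
  rewrite opprK addrC -dualBr; apply: le_trans (dual_ler_norm _ _) _.
  by rewrite distrC.
by rewrite ler_norml H andbT lerNl opprB distrC H.
Qed.

Lemma attains_dual_norm (g : dual_space E) :
  attains_inf [set x | `|x| <= 1] (fun x => (- g x)%:E) ->
  exists2 x0 : E, `|x0| <= 1 & g x0 = `|g|.
Proof.
move=> /attains_inf_le[x0 x01 x0min]; exists x0 => //.
apply/eqP; rewrite eq_le; apply/andP; split.
  by apply: le_trans (dual_ler_norm _ _) _; rewrite ler_piMr.
by apply: dual_norm_ball => x /x0min; rewrite lee_fin lerN2.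
Qed.

End unit_ball.

Section support_gap.
Context (R : realType) (E : normedModType R) (g : dual_space E).

(** The infimum is [- `|g| / 2], approached on the sphere of radius one half, where
    [`|g| * `|x| - g x] is to vanish. The slope [2 * `|g|] dominates that of [g], which
    makes the function coercive. A multiple of the norm alone, if large enough to
    make its sum with [- g] coercive, would put the minimum at the origin. *)
Definition support_gap (x : E) : R := Num.max (2 * `|g| * `|x| - `|g|) 0 - g x.

Lemma support_gap_ge x : `|g| * `|x| - `|g| <= support_gap x.
Proof.
have := dual_ler_norm g x; rewrite /support_gap.
have : 2 * `|g| * `|x| - `|g| <= Num.max (2 * `|g| * `|x| - `|g|) 0.
  by rewrite le_max lexx.
move: (Num.max _ _) (g x : R) => p q; lra.
Qed.

Lemma support_gap_convex : convex_on setT (EFin \o support_gap).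
Proof.
move=> x y t _ _ /andP[t0 t1].
rewrite /= -!EFinM -EFinD lee_fin /support_gap dualDr !dualZr.
set p := fun z : E => Num.max (2 * `|g| * `|z| - `|g|) 0.
have p0 z : 0 <= p z by rewrite le_max lexx orbT.
have pz z : 2 * `|g| * `|z| - `|g| <= p z by rewrite le_max lexx.
have t1' : 0 <= 1 - t by rewrite subr_ge0.
have pxy : p (t *: x + (1 - t) *: y) <= t * p x + (1 - t) * p y.
  rewrite ge_max addr_ge0 ?mulr_ge0// andbT.
  apply: (@le_trans _ _ (t * (2 * `|g| * `|x| - `|g|) + (1 - t) * (2 * `|g| * `|y| - `|g|))).
    have : `|t *: x + (1 - t) *: y| <= t * `|x| + (1 - t) * `|y|.
      by apply: le_trans (ler_normD _ _) _; rewrite !normrZ !ger0_norm.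
    move=> /(ler_wpM2l (normr_ge0 g)); lra.
  by apply: lerD; exact: ler_wpM2l.
by move: pxy; rewrite -/(p _) -/(p x) -/(p y); move: (g x : R) (g y : R) => a b; lra.
Qed.

Lemma support_gap_lipschitz x y :
  `|support_gap x - support_gap y| <= 3 * `|g| * `|x - y|.
Proof.
have half a b : support_gap a - support_gap b <= 3 * `|g| * `|a - b|.
  have gab : g b - g a <= `|g| * `|a - b|.
    by rewrite -dualBr distrC dual_ler_norm.
  have ab : `|g| * `|a| <= `|g| * `|a - b| + `|g| * `|b|.
    by rewrite -mulrDr ler_wpM2l//; have := ler_distD b a 0; rewrite !subr0.
  have : Num.max (2 * `|g| * `|a| - `|g|) 0 <=
         Num.max (2 * `|g| * `|b| - `|g|) 0 + 2 * `|g| * `|a - b|.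
    rewrite ge_max; apply/andP; split.
      have : 2 * `|g| * `|b| - `|g| <= Num.max (2 * `|g| * `|b| - `|g|) 0.
        by rewrite le_max lexx.
      lra.
    by rewrite addr_ge0 ?mulr_ge0// le_max lexx orbT.
  rewrite /support_gap; move: gab; move: (Num.max _ _) (Num.max _ _) => p q.
  by move: (g a : R) (g b : R) => c d; lra.
by rewrite ler_norml half andbT lerNl opprB distrC half.
Qed.

(** The points of the ball of radius one half give [support_gap x0 <= - `|g| / 2].
    Comparing with both branches of the maximum and with [g x0 <= `|g| * `|x0|]
    leaves only [`|x0| <= 1 / 2] and [g x0 = `|g| / 2]. *)
Lemma support_gap_attains : attains_inf setT (EFin \o support_gap) ->
  exists2 x0 : E, `|x0| <= 1 & g x0 = `|g|.
Proof.
move=> /attains_inf_le[x0 _ x0min].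
have [->|g0] := eqVneq g 0; first by exists 0; rewrite ?normr0.
have m0 : 0 < `|g| by rewrite normr_gt0.
have gap_half : `|g| <= - 2 * support_gap x0.
  apply: dual_norm_ball => x x1.
  have := x0min (2^-1 *: x) I; rewrite /= lee_fin /support_gap dualZr.
  have -> : Num.max (2 * `|g| * `|2^-1 *: x| - `|g|) 0 = 0.
    apply/max_idPr; rewrite normrZ gtr0_norm ?invr_gt0//.
    have : `|g| * `|x| <= `|g| by rewrite ler_piMr.
    lra.
  by move: (Num.max _ _) (g x : R) (g x0 : R) => p q s; lra.
have gx0 := dual_ler_norm g x0.
move: gap_half; rewrite /support_gap.
have p0 : 0 <= Num.max (2 * `|g| * `|x0| - `|g|) 0 by rewrite le_max lexx orbT.
have px0 : 2 * `|g| * `|x0| - `|g| <= Num.max (2 * `|g| * `|x0| - `|g|) 0.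
  by rewrite le_max lexx.
move=> gap_half.
have mx0 : `|g| * `|x0| <= `|g| * 2^-1.
  by move: gap_half p0 px0 gx0; move: (Num.max _ _) (g x0 : R) => p q; lra.
exists (2 *: x0).
  rewrite normrZ gtr0_norm//; rewrite ler_pM2l// in mx0; lra.
rewrite dualZr; move: gap_half p0 px0 gx0 mx0.
by move: (Num.max _ _) (g x0 : R) => p q; lra.
Qed.

Lemma support_gap_coercive : g != 0 -> coercive_on setT (EFin \o support_gap).
Proof.
move=> g0; have m0 : 0 < `|g| by rewrite normr_gt0.
split=> [/bounded_setP[M EM]|M].
  have [x x0] : exists x, g x != 0.
    apply: contrapT => ng; move/negP: g0; apply; apply/eqP.
    apply: dual_norm_eq0; apply/eqP; rewrite eq_le dual_norm_ge0 andbT.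
    apply: dual_norm_ball => x _; rewrite leNgt; apply/negP => gx.
    by apply: ng; exists x; rewrite gt_eqF.
  have nx : 0 < `|x|.
    by rewrite normr_gt0; apply: contraNneq x0 => ->; rewrite linear0.
  have := EM (((`|M| + 1) / `|x|) *: x) I.
  rewrite normrZ ger0_norm ?divr_ge0 ?addr_ge0// divfK ?gt_eqF//.
  by have := ler_norm M; lra.
exists ((M + `|g|) / `|g|) => x _; rewrite ltr_pdivrMr// lte_fin => Mx.
apply: lt_le_trans (support_gap_ge x).
by rewrite mulrC ltrBrDr.
Qed.

End support_gap.

(** * The equivalence *)

Unset Implicit Arguments.

Theorem theorem1p7 (R : realType) (E : completeNormedModType R) :
  [<->
    (* 1 *)
    reflexive_space E;
    (* 2 *)
    forall f : E -> \bar R,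
      ninfty_free setT f -> proper_on setT f -> lsc_on setT f ->
      convex_on setT f ->
      (exists u : nat -> E,
        minimizing_sequence setT f u /\ bounded_set (range u)) ->
      attains_inf setT f;
    (* 3 *)
    forall (A : set E) (f : E -> \bar R),
      bounded_set A -> A !=set0 -> closed A -> convex_set A ->
      ninfty_free A f -> proper_on A f -> lsc_on A f -> convex_on A f ->
      attains_inf A f;
    (* 4 *)
    forall (A : set E) (f : E -> R),
      ~ bounded_set A -> closed A -> convex_set A ->
      coercive_on A (EFin \o f) -> lsc_on A (EFin \o f) ->
      convex_on A (EFin \o f) ->
      attains_inf A (EFin \o f);
    (* 5 *)
    forall (A : set E) (f : E -> R),
      ~ bounded_set A -> closed A -> convex_set A ->
      bounded_function_on A f ->
      coercive_on A (EFin \o f) -> lsc_on A (EFin \o f) ->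
      convex_on A (EFin \o f) ->
      attains_inf A (EFin \o f);
    (* 6 *)
    forall f : E -> R,
      coercive_on setT (EFin \o f) -> convex_on setT (EFin \o f) ->
      [lipschitz f x | x in setT] ->
      attains_inf setT (EFin \o f);
    (* 7 *)
    forall (A : set E) (f : E -> \bar R),
      ~ bounded_set A -> closed A -> convex_set A ->
      ninfty_free A f -> proper_on A f -> lsc_on A f -> coercive_on A f ->
      convex_on A f ->
      attains_inf A f;
    (* 8 *)
    forall f : E -> \bar R,
      ninfty_free setT f -> proper_on setT f -> lsc_on setT f ->
      convex_on setT f ->
      (exists (beta : R) (phi : R -> R),
        [/\ forall t, 0 <= t -> 0 <= phi t,
            forall s t, 0 <= s -> s <= t -> phi s <= phi t,
            phi t @[t --> +oo] --> +oo &
            forall x : E, ((phi `|x| + beta)%:E <= f x)%E]) ->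
      attains_inf setT f;
    (* 9 *)
    forall g : dual_space E, exists2 x0 : E, `|x0| <= 1 & g x0 = `|g|
  ].
Proof.
have proper_real (f : E -> R) (A : set E) : A !=set0 -> proper_on A (EFin \o f).
  by move=> [x Ax]; exists x => //=; exact: ltry.
have proper_unbounded (f : E -> R) (A : set E) :
    ~ bounded_set A -> proper_on A (EFin \o f).
  move=> Aoo; apply: proper_real; apply: contrapT => /set0P/negP/negPn/eqP A0.
  by apply: Aoo; apply/bounded_setP; exists 0 => x; rewrite A0.
have gap_ninfty (g : dual_space E) : ninfty_free setT (EFin \o support_gap g).
  by move=> x _ /=; exact: ltNyr.
have gap_proper (g : dual_space E) : proper_on setT (EFin \o support_gap g).
  by apply: proper_real; exists 0.
have gap_lsc (g : dual_space E) : lsc_on setT (EFin \o support_gap g).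
  exact: lipschitz_lsc (support_gap_lipschitz g).
have cvxT : convex_set [set: E] by apply/convex_setP.
have attain0 : exists2 x0 : E, `|x0| <= 1 & (0 : dual_space E) x0 = `|0 : dual_space E|.
  by exists 0; rewrite ?normr0.
have attains_of_gap : (forall g : dual_space E, g != 0 ->
    attains_inf setT (EFin \o support_gap g)) ->
    forall g : dual_space E, exists2 x0 : E, `|x0| <= 1 & g x0 = `|g|.
  move=> H g; have [->|g0] := eqVneq g 0; first exact: attain0.
  exact/support_gap_attains/H.
tfae.
- move=> reflE f _ pf lscf cvxf [u [[_ _ uI] /bounded_setP[M uM]]].
  apply: (reflexive_attains_inf (M := M)) => // a Ia.
  have [n fua] : exists n, (f (u n) <= a%:E)%E.
    apply: contrapT => nou; have := Ia; rewrite ltNge => /negP; apply.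
    apply: (cvge_ge _ uI); apply: nearW => n; rewrite leNgt; apply/negP => /ltW ua.
    by apply: nou; exists n.
  by exists (u n); split=> //; apply: uM; exists n.
- move=> H2; suff reflE : reflexive_space E.
    move=> A f /bounded_setP[M AM] _ clA cvxA _ pf lscf cvxf.
    apply: reflexive_coercive_attains_inf => // m; exists M => x /AM.
    by rewrite leNgt => /negP.
  apply/james/attains_of_gap => g g0; apply: H2 => //; first exact: support_gap_convex.
  (* A nonincreasing sequence of values stays below the first one, and coercivity
     then bounds the points. *)
  have [u umin] := minimizing_sequence_exists (gap_proper g).
  exists u; split=> //; have [_ udecr _] := umin.
  have m0 : 0 < `|g| by rewrite normr_gt0.
  apply/bounded_setP; exists ((support_gap g (u 0%N) + `|g|) / `|g|) => _ [n _ <-].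
  rewrite ler_pdivlMr// mulrC -lerBlDr; apply: le_trans (support_gap_ge g _) _.
  by have := udecr _ _ (leq0n n); rewrite lee_fin.
- move=> H3; suff reflE : reflexive_space E.
    move=> A f Aoo clA cvxA [_ coer] lscf cvxf.
    by apply: reflexive_coercive_attains_inf => //; exact: proper_unbounded.
  apply: james => g; apply/attains_dual_norm/H3.
  + by apply/bounded_setP; exists 1.
  + by exists 0; rewrite /= normr0.
  + exact: unit_ball_closed.
  + exact: unit_ball_convex.
  + by move=> x _; exact: ltNyr.
  + by exists 0; rewrite /= ?normr0 ?ltry.
  + by move=> x u _ _; exact: dual_opp_lsc.
  + move=> x y t _ _ _.
    by rewrite -!EFinM -EFinD lee_fin dualDr !dualZr opprD !mulrN.
- by move=> H4 A f Aoo clA cvxA _; exact: H4.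
- move=> H5 f fcoer cvxf /lipschitz_setTP[k fk].
  apply: H5 => //; [exact: fcoer.1| |exact: lipschitz_lsc fk].
  move=> B _ /bounded_setP[M BM]; apply/bounded_setP.
  exists (`|f 0| + `|k| * M) => _ [x Bx <-].
  rewrite -[f x](subrK (f 0)) addrC; apply: le_trans (ler_normD _ _) _.
  rewrite lerD2l; apply: le_trans (fk _ _) _; rewrite subr0.
  apply: (@le_trans _ _ (`|k| * `|x|)); first by rewrite ler_wpM2r// ler_norm.
  by rewrite ler_wpM2l// BM.
- move=> H6; suff reflE : reflexive_space E.
    move=> A f _ clA cvxA _ pf lscf [_ coer] cvxf.
    exact: reflexive_coercive_attains_inf.
  apply/james/attains_of_gap => g g0; apply: H6.
  + exact: support_gap_coercive.
  + exact: support_gap_convex.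
  + apply/lipschitz_setTP; exists (3 * `|g|); exact: support_gap_lipschitz.
- move=> H7; suff reflE : reflexive_space E.
    move=> f _ pf lscf cvxf [beta [phi [_ phi_mono phioo fphi]]].
    apply: reflexive_coercive_attains_inf => // M.
    move/cvgryPgt: phioo => /(_ (M - beta))[r [_ rphi]].
    exists r => x _ /rphi /= xM; apply: lt_le_trans (fphi x).
    by rewrite lte_fin -ltrBlDr.
  apply/james/attains_of_gap => g g0.
  have gcoer := support_gap_coercive g0.
  by apply: H7 => //; [exact: gcoer.1|exact: support_gap_convex].
- move=> H8; apply: attains_of_gap => g g0; apply: H8 => //.
    exact: support_gap_convex.
  have m0 : 0 < `|g| by rewrite normr_gt0.
  exists (- `|g|), (fun t => `|g| * t); split.
  + by move=> t t0; rewrite mulr_ge0.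
  + by move=> s t _ st; rewrite ler_wpM2l.
  + apply/cvgryPgt => a; exists (a / `|g|); split=> [|t]; first exact: num_real.
    by rewrite ltr_pdivrMr// mulrC.
  + by move=> x; rewrite lee_fin support_gap_ge.
- exact: james.
Qed.
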